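(* Let $G$ be a finite connected unweighted graph, and let $\Gamma$ be the metric graph of genus $g$ obtained from $G$ by turning each edge into a segment of length $1$; assume $\Gamma$ is neither a point nor a circle. Let $0\le d\le g$ and let $D$ be an integral divisor of degree $d$ (a divisor on $\Gamma$ supported on $V(G)$) that is linearly equivalent on $\Gamma$ to some effective integral divisor. Then $|D|$ contains an integral semibreak divisor. Moreover, every semibreak divisor in $|D|$ is integral.
   Context: A metric graph is a compact connected metric space $\Gamma$ in which every point has a neighborhood isometric to a star-shaped set $\{te^{2\pi i k/n}\in\mathbb{C} : 0\le t<r,\ k\in\mathbb{Z}\}$ (finite valency $n$, radius $r>0$) with the path metric; $n$ is the valency of the point. Its genus is $g=\dim H_1(\Gamma;\mathbb{R})$. $V_\Gamma$ is the finite set of branch points (points of valency $\ne 2$). The open edges of $\Gamma$ are the connected components of $\Gamma\setminus V_\Gamma$; an open edge segment is a (nonempty) open connected subset of an open edge. A divisor is an element $D=\sum_p D(p)\,(p)$ of the free abelian group on the points of $\Gamma$; $\deg D=\sum_p D(p)$; $\mathrm{supp}(D)=\{p: D(p)\neq 0\}$; $D$ is effective if all $D(p)\ge 0$; $E\le D$ means $D-E$ is effective. A divisor is integral if its support is contained in $V(G)$. $R(\Gamma)$ is the group of continuous piecewise affine functions $\phi:\Gamma\to\mathbb{R}$ with integer slopes (finitely many slope changes on each edge), and $\mathrm{div}(\phi)=\sum_p\sigma_p(\phi)(p)$, where $\sigma_p(\phi)$ is the sum of incoming slopes of $\phi$ at $p$ (i.e. minus the sum of the outgoing slopes). $D_1\sim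 D_2$ (linear equivalence) means $D_1-D_2=\mathrm{div}(\phi)$ for some $\phi\in R(\Gamma)$. $|D|$ is the set of all effective divisors on $\Gamma$ (integral or not) linearly equivalent to $D$. A break divisor is a divisor $(p_1)+\cdots+(p_g)$ for which there exist pairwise disjoint open edge segments $e_1,\dots,e_g$ with $p_i\in\overline{e_i}$ and such that $\Gamma\setminus\bigcup_{i=1}^g e_i$ is contractible. A semibreak divisor is an effective divisor $E$ such that $E\le D$ for some break divisor $D$. *)

(* Defs.v *)
From HB Require Import structures.
From mathcomp Require Import all_boot all_order all_algebra.
From mathcomp Require Import all_classical all_reals all_analysis.
From mathcomp Require Import freeg.
From mathcomp Require Import ring lra.

Set Implicit Arguments.
Unset Strict Implicit.
Unset Printing Implicit Defensive.

Import Order.TTheory GRing.Theory Num.Theory.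
Import numFieldNormedType.Exports.

Local Open Scope classical_set_scope.
Local Open Scope ring_scope.

(* Multiple edges and loops are allowed; [src] and [tgt] fix an arbitrary
   orientation of each edge. *)
Record graph := Graph {
  vertex : finType;
  edge : finType;
  src : edge -> vertex;
  tgt : edge -> vertex;
  vertex_gt0 : (0 < #|vertex|)%N;
  graph_connected : forall u v : vertex,
    connect (fun a b => [exists e, ((src e == a) && (tgt e == b))
                                   || ((src e == b) && (tgt e == a))]) u v }.

(* A point of the realization is a vertex, or an edge together with an interior
   parameter in ]0, 1[. *)
Definition mgraph (R : realType) (G : graph) : Type :=
  (vertex G + edge G * {t : R | 0 < t < 1})%type.

Section Realization.
Context {R : realType} {G : graph}.
Implicit Types (e : edge G) (v : vertex G).
Local Notation Gam := (mgraph R G).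

HB.instance Definition _ := Choice.copy Gam
  (vertex G + edge G * {t : R | 0 < t < 1})%type.

Definition vpoint v : Gam := inl v.

(* The unit-speed parametrization [0, 1] -> Gam of the closed edge e (clamped
   outside of [0, 1]). *)
Definition epoint e (t : R) : Gam :=
  if (insub t : option {t : R | 0 < t < 1}) is Some u then inr (e, u)
  else inl (if t <= 0 then src e else tgt e).

(* l is the length of a path from x to y made of finitely many segments, each
   inside a closed edge; the path metric is the infimum of these lengths. *)
Inductive path_length : Gam -> Gam -> R -> Prop :=
| PathNil x : path_length x x 0
| PathCons e s t y l : 0 <= s <= 1 -> 0 <= t <= 1 ->
    path_length (epoint e t) y l ->
    path_length (epoint e s) y (`|s - t| + l).

Definition path_dist (x y : Gam) : R := inf [set l | path_length x y l].

Lemma epoint0 e : epoint e 0 = vpoint (src e).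
Proof. by rewrite /epoint insubF ?lexx ?ltxx. Qed.

Lemma epoint1 e : epoint e 1 = vpoint (tgt e).
Proof. by rewrite /epoint insubF ?ltxx ?andbF// ler10. Qed.

Lemma epoint_in e (u : {t : R | 0 < t < 1}) : epoint e (val u) = inr (e, u).
Proof. by rewrite /epoint valK. Qed.

Lemma epointE e (t : R) (ht : 0 < t < 1) :
  epoint e t = inr (e, exist (fun t : R => is_true (0 < t < 1)) t ht).
Proof. by rewrite -epoint_in. Qed.

Variant unit_itv_spec (t : R) : Prop :=
| Unit0 of t = 0 | Unit1 of t = 1 | UnitIn of 0 < t < 1.

Lemma unit_itvP t : 0 <= t <= 1 -> unit_itv_spec t.
Proof.
move=> /andP[t0 t1]; have [->|tn0] := eqVneq t 0; first exact: Unit0.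
have [->|tn1] := eqVneq t 1; first exact: Unit1.
by apply: UnitIn; rewrite !lt_neqAle t0 t1 tn1 eq_sym tn0.
Qed.

Lemma path_length_ge0 x y l : path_length x y l -> 0 <= l.
Proof. by elim=> // e s t z m _ _ _ m0; rewrite addr_ge0. Qed.

Lemma path_length_cat x y z l m :
  path_length x y l -> path_length y z m -> path_length x z (l + m).
Proof.
move=> p; elim: p z m => [{}x z m|e s t {}y k hs ht _ IH z m pm].
  by rewrite add0r.
by rewrite -addrA; apply: PathCons => //; exact: IH.
Qed.

Lemma path_length1 e s t : 0 <= s <= 1 -> 0 <= t <= 1 ->
  path_length (epoint e s) (epoint e t) `|s - t|.
Proof.
by move=> hs ht; rewrite -[`|_|]addr0; apply: PathCons => //; exact: PathNil.
Qed.

Lemma path_length_sym x y l : path_length x y l -> path_length y x l.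
Proof.
elim=> [{}x|e s t {}y m hs ht _ IH]; first exact: PathNil.
rewrite addrC; apply: path_length_cat IH _.
by rewrite distrC; exact: path_length1.
Qed.

Lemma path_length_vertex x : exists v l, path_length x (vpoint v) l.
Proof.
case: x => [v|[e u]]; first by exists v, 0; exact: PathNil.
exists (src e), `|val u - 0|; rewrite -epoint0 -epoint_in.
by apply: path_length1; have := valP u; lra.
Qed.

Lemma path_length_ex x y : exists l, path_length x y l.
Proof.
have [u [l xu]] := path_length_vertex x.
have [v [m yv]] := path_length_vertex y.
suff [k uv] : exists k, path_length (vpoint u) (vpoint v) k.
  exists (l + k + m); apply: path_length_cat (path_length_sym yv).
  exact: path_length_cat uv.
have /connectP[p] := graph_connected u v.
elim: p u {xu} => [u _ ->|w p IH u]; first by exists 0; exact: PathNil.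
move=> /= /andP[/existsP[e he] /IH{}IH] /IH[k wv].
suff [j uw] : exists j, path_length (vpoint u) (vpoint w) j.
  by exists (j + k); exact: path_length_cat wv.
have h01 : path_length (vpoint (src e)) (vpoint (tgt e)) `|0 - 1|.
  by rewrite -epoint0 -epoint1; apply: path_length1; rewrite !lexx ler01.
exists `|0 - 1|; case/orP: he => /andP[/eqP <- /eqP <-] //.
exact: path_length_sym.
Qed.

Lemma has_inf_path x y : has_inf [set l | path_length x y l].
Proof.
split; first by have [l] := path_length_ex x y; exists l.
by exists 0 => l /path_length_ge0.
Qed.

Lemma path_dist_le x y l : path_length x y l -> path_dist x y <= l.
Proof. by move=> p; apply: ge_inf => //; case: (has_inf_path x y). Qed.

Lemma path_dist_ge x y k : (forall l, path_length x y l -> k <= l) ->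
  k <= path_dist x y.
Proof. by move=> h; apply: lb_le_inf => //; case: (has_inf_path x y). Qed.

Lemma path_dist_ge0 x y : 0 <= path_dist x y.
Proof. by apply: path_dist_ge => l /path_length_ge0. Qed.

Lemma path_distxx x : path_dist x x = 0.
Proof.
by apply/le_anti; rewrite path_dist_ge0 andbT; apply: path_dist_le; exact: PathNil.
Qed.

Lemma path_dist_sym x y : path_dist x y = path_dist y x.
Proof.
by apply/le_anti/andP; split; apply: path_dist_ge => l /path_length_sym;
  exact: path_dist_le.
Qed.

Lemma path_dist_triangle y x z :
  path_dist x z <= path_dist x y + path_dist y z.
Proof.
rewrite -lerBlDr; apply: path_dist_ge => l xy.
rewrite lerBlDr -lerBlDl; apply: path_dist_ge => m yz.
by rewrite lerBlDl; apply: path_dist_le; exact: path_length_cat yz.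
Qed.

Lemma path_dist_separate (h : Gam -> R) x y :
  (forall e s t, 0 <= s <= 1 -> 0 <= t <= 1 ->
     `|h (epoint e s) - h (epoint e t)| <= `|s - t|) ->
  path_dist x y = 0 -> h x = h y.
Proof.
move=> hh xy0; apply/eqP; rewrite -subr_eq0 -normr_le0 -{1}xy0.
apply: path_dist_ge => l.
elim=> [{xy0}x|e s t {xy0}y m hs ht _ IH]; first by rewrite subrr normr0.
by rewrite (le_trans (ler_distD (h (epoint e t)) _ _))// lerD// hh.
Qed.

Let bump_v v (x : Gam) : R :=
  match x with
  | inl w => (w != v)%:R / 2
  | inr (e, u) => Num.min (1 / 2)
      (Num.min ((src e != v)%:R / 2 + val u) ((tgt e != v)%:R / 2 + 1 - val u))
  end.

Let bump_vE v e t : 0 <= t <= 1 -> bump_v v (epoint e t) = Num.min (1 / 2)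
   (Num.min ((src e != v)%:R / 2 + t) ((tgt e != v)%:R / 2 + 1 - t)).
Proof.
case/unit_itvP => [->|->|ht]; last by rewrite epointE.
- rewrite epoint0 /=; case: (src e == v); case: (tgt e == v) => /=;
  rewrite /Num.min; do ?case: ifPn; lra.
- rewrite epoint1 /=; case: (src e == v); case: (tgt e == v) => /=;
  rewrite /Num.min; do ?case: ifPn; lra.
Qed.

Let bump_e e0 (u0 : R) (x : Gam) : R :=
  match x with
  | inl _ => 0
  | inr (e, u) => if e == e0 then
      Num.max 0 (Num.min u0 (1 - u0) - `|val u - u0|) else 0
  end.

Let bump_eE e0 (u0 : R) e t : 0 < u0 < 1 -> 0 <= t <= 1 ->
  bump_e e0 u0 (epoint e t) = if e == e0 then
      Num.max 0 (Num.min u0 (1 - u0) - `|t - u0|) else 0.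
Proof.
move=> hu; case/unit_itvP => [->|->|ht]; last by rewrite epointE.
- rewrite epoint0 /=; case: ifP => // _; rewrite sub0r normrN gtr0_norm; last lra.
  rewrite /Num.min /Num.max; do ?case: ifPn; lra.
- rewrite epoint1 /=; case: ifP => // _; rewrite gtr0_norm; last lra.
  rewrite /Num.min /Num.max; do ?case: ifPn; lra.
Qed.

Lemma path_dist_positivity x y : path_dist x y = 0 -> x = y.
Proof.
case: x => [v|[e u]].
- move=> /(@path_dist_separate (bump_v v)) => /(_ _)/wrap[e s t hs ht|].
    rewrite !bump_vE//.
    set a := _ / 2; set b := _ / 2; rewrite ler_norml.
    have := ler_norm (s - t); have := ler_norm (t - s); rewrite (distrC t).
    set n := `| _ |; rewrite /Num.min; do ?case: ifPn; lra.
  rewrite /= eqxx mul0r; case: y => [w|[e [u hu]]] /=.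
    have [->|_] /= := eqVneq w v => // h; have : (0 : R) < 1 / 2 by lra.
    by rewrite -h ltxx.
  move=> h; exfalso; move: h; case: (src e == v); case: (tgt e == v) => /=;
    rewrite /Num.min; do ?case: ifPn; lra.
- have /= hu := valP u.
  move=> /(@path_dist_separate (bump_e e (val u))) => /(_ _)/wrap[e1 s t hs ht|].
    rewrite !bump_eE//.
    case: ifP => _; last by rewrite subrr normr0.
    have := ler_distD t s (val u); have := ler_distD s t (val u).
    rewrite (distrC t s); set a := `|s - val u|; set b := `|t - val u|.
    set n := `|s - t|; set m := Num.min _ _ => h1 h2.
    by rewrite ler_norml /Num.max; do ?case: ifPn; lra.
  rewrite /= eqxx subrr normr0; case: y => [w|[e1 u1]] /=.
    move=> h; exfalso; move: h; rewrite /Num.max /Num.min; do ?case: ifPn; lra.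
  have [->|_] := eqVneq e1 e; last first.
    move=> h; exfalso; move: h; rewrite /Num.max /Num.min; do ?case: ifPn; lra.
  move=> h; suff /eqP : `|val u1 - val u| = 0.
    by rewrite normr_eq0 subr_eq0 => /eqP/val_inj ->.
  have := normr_ge0 (val u1 - val u); move: h; set n := `|_|.
  rewrite /Num.max /Num.min; do ?case: ifPn; lra.
Qed.

HB.instance Definition _ := @isMetric.Build R Gam path_dist
  path_distxx path_dist_positivity path_dist_sym path_dist_triangle.

End Realization.
Arguments mgraph R G : clear implicits.

Section MetricSpace.
Context {R : realType} {M : metricType R}.
Implicit Types (p : M) (A : set M).

(* The star-shaped set of valency n and radius r is presented by its n rays
   k : 'I_n, the point at parameter t on ray k being t e^{2 pi i k / n}; its path
   metric is |s - t| on a common ray and s + t across the centre.  The centre is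
   added by hand to the image so that the case n = 0 is covered. *)
Definition has_valency p (n : nat) : Prop :=
  exists (r : R) (f : 'I_n -> R -> M),
    [/\ 0 < r,
        forall k, f k 0 = p,
        forall k l (s t : R), 0 <= s < r -> 0 <= t < r ->
          mdist (f k s) (f l t) = if k == l then `|s - t| else s + t &
        nbhs p (p |` \bigcup_k (f k @` `[0, r[))].

Definition branch_points : set M :=
  [set p | exists2 n, n <> 2%N & has_valency p n].

Definition open_edge A : Prop :=
  exists2 p, ~ branch_points p & A = connected_component (~` branch_points) p.

Definition open_edge_segment A : Prop :=
  [/\ A !=set0, open A, connected A & exists2 B, open_edge B & A `<=` B].

Definition contractible A : Prop :=
  exists (H : R * M -> M) (c : M),
    [/\ A c,
        {within `[0, 1] `*` A, continuous H},
        forall (t : R) x, 0 <= t <= 1 -> A x -> A (H (t, x)),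
        forall x, A x -> H (0, x) = x &
        forall x, A x -> H (1, x) = c].

End MetricSpace.
Arguments branch_points {R} M.

Definition is_point (R : realType) (M : metricType R) : Prop :=
  exists p : M, forall q : M, q = p.

Definition unit_circle {R : realType} : set (R * R) :=
  [set z | z.1 ^+ 2 + z.2 ^+ 2 = 1].

Definition is_circle (R : realType) (M : metricType R) : Prop :=
  exists (f : M -> R * R) (h : R * R -> M),
    [/\ continuous f, {within unit_circle, continuous h},
        forall x, unit_circle (f x),
        cancel f h & forall z, unit_circle z -> f (h z) = z].

(* mgraph R G is a one-dimensional cell complex with cells the vertices and edges
   of G, so that H_1 is the kernel of the boundary map e |-> tgt e - src e on
   R-valued 1-chains (row vectors). *)
Definition boundary (R : realType) (G : graph) :
    'M[R]_(#|edge G|, #|vertex G|) :=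
  \matrix_(i, j) ((tgt (enum_val i) == enum_val j)%:R
                  - (src (enum_val i) == enum_val j)%:R).

Definition genus (R : realType) (G : graph) : nat := \rank (kermx (boundary R G)).

Notation divisor R G := {freeg (mgraph R G)}.

Section Divisors.
Context {R : realType} {G : graph}.
Local Notation Gam := (mgraph R G).
Implicit Types (D E : divisor R G) (phi : Gam -> R).

Definition effective D : Prop := forall p, 0 <= coeff p D.

Definition integral_divisor D : Prop :=
  forall p, coeff p D != 0 -> exists v : vertex G, p = vpoint v.

Definition piecewise_affine phi : Prop :=
  forall e : edge G, exists2 s : seq R, itv_partition 0 1 s &
    forall i, (i < size s)%N -> exists m : int,
      let a := nth 0 (0 :: s) i in let b := nth 0 (0 :: s) i.+1 in
      forall t : R, a <= t <= b ->
        phi (epoint e t) = phi (epoint e a) + m%:~R * (t - a).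

Definition rational_function phi : Prop := continuous phi /\ piecewise_affine phi.

(* Unit-speed rays leaving x, one for each tangent direction at x; a loop
   contributes two of them. *)
Definition rays (x : Gam) : seq (R -> Gam) :=
  match x with
  | inl v => [seq (fun h : R => epoint e h) | e <- enum (edge G) & src e == v] ++
             [seq (fun h : R => epoint e (1 - h)) | e <- enum (edge G) & tgt e == v]
  | inr (e, t) => [:: (fun h : R => epoint e (val t + h));
                      (fun h : R => epoint e (val t - h))]
  end.

Definition outgoing_slope phi (ray : R -> Gam) : R :=
  lim ((phi (ray h) - phi (ray 0)) / h @[h --> 0^'+]).

(* sigma_x(phi), the coefficient of div(phi) at x *)
Definition div_coeff phi (x : Gam) : R :=
  - \sum_(ray <- rays x) outgoing_slope phi ray.

Definition linear_equiv D E : Prop :=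
  exists2 phi, rational_function phi &
    forall x, (coeff x (D - E))%:~R = div_coeff phi x.

Definition linear_system D : set (divisor R G) :=
  [set E | effective E /\ linear_equiv E D].

Definition break_divisor D : Prop :=
  exists (p : 'I_(genus R G) -> Gam) (e : 'I_(genus R G) -> set Gam),
    [/\ D = \sum_i << p i >>,
        forall i, open_edge_segment (e i) /\ closure (e i) (p i),
        trivIset setT e &
        contractible (~` \bigcup_i e i)].

Definition semibreak_divisor E : Prop :=
  effective E /\ exists2 D, break_divisor D & effective (D - E).

End Divisors.

(* Main.v *)
Require Import Defs.
From mathcomp Require Import all_boot all_order all_algebra.
From mathcomp Require Import all_classical all_reals all_analysis.
From mathcomp Require Import freeg.
From mathcomp Require Import zify ring lra.

(* Existence.  Write the divisors of G equivalent to the given effective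
   divisor D0 as E = D0 - lap f with f an integer function on the vertices
   vanishing at a base vertex q.  Among the finitely many f for which E is
   effective, minimize the energy of E relative to half the canonical divisor,
   and then the sum of f.  Then E satisfies Rado's condition for being
   transversal to the cographic matroid.  Indeed, if S is a minimal set of
   vertices violating it, then each component C of G - S may legally borrow one
   chip along every edge leaving it; since deg E <= g, some component C carries
   at most (genus of C) - 1 chips.  If q is not in C, borrowing by C does not
   increase the energy and decreases the sum of f; if C contains q and is the
   only such component, firing the complement of C strictly decreases the
   energy.  Rado's theorem now attaches to each chip of E its own edge, incident
   to the chip, so that the removal of these edges leaves G connected; the
   complement of a spanning tree avoiding these edges gives a break divisor.

   Integrality.  Let E be a semibreak divisor below the break divisor
   p_1 + ... + p_g with segments e_1, ..., e_g, and div(phi) = E - D.  Puncturing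
   the graph at one point of e_i for each p_i inside an edge of G does not
   disconnect it: a new piece would lie inside some e_i, hence contain only
   vertices of degree 2, and would have a single end, against the handshake
   lemma.  So an edge of G contains at most one p_i in its interior, and phi
   takes the same value modulo 1 at all the vertices.  But an edge with one chip
   of E at interior parameter u has phi(tgt) - phi(src) = u modulo 1. *)

Set Implicit Arguments.
Unset Strict Implicit.
Unset Printing Implicit Defensive.

Import Order.TTheory GRing.Theory Num.Theory.
Import numFieldNormedType.Exports.

Local Open Scope ring_scope.

(** * Rado's theorem and the cographic matroid *)

(** Rado's theorem, by induction on the total size of the sets: if some [A i] has two elements, one
    of the two can be deleted without breaking the condition. When every set is a singleton, the
    condition is already the conclusion. *)
Lemma rado_transversal (I T : finType) (r : {set T} -> nat)
    (r0 : r finset.set0 = 0%N)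
    (r_mono : forall A B : {set T}, A \subset B -> (r A <= r B)%N)
    (r_submod : forall A B : {set T}, (r (A :|: B) + r (A :&: B) <= r A + r B)%N)
    (A : I -> {set T}) :
  (forall K : {set I}, (#|K| <= r (\bigcup_(i in K) A i)%SET)%N) ->
  exists x : I -> T, (forall i, x i \in A i) /\
    forall K : {set I}, (#|K| <= r (x @: K))%N.
Proof.
have [n] := ubnP (\sum_i #|A i|)%N; elim: n A => // n IH A le_n hA.
have A_neq0 i : exists x, x \in A i.
  apply/finset.set0Pn/eqP => Ai0; have := hA [set i]%SET.
  by rewrite cards1 big_set1 Ai0 r0.
have [i gt1|le1] := pickP [pred i | (1 < #|A i|)%N]; last first.
  exists (fun i => xchoose (A_neq0 i)); split=> [i|K]; first exact: xchooseP.
  apply: (leq_trans (hA K)); apply: r_mono; apply/bigcupsP => i iK.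
  apply/fintype.subsetP => y yA; apply/imsetP; exists i => //.
  have := le1 i; rewrite /= ltnNge => /negbFE /card_le1_eqP; apply => //.
  exact: xchooseP.
have /card_gt1P[x [y [xA yA xy]]] := gt1.
pose B z j := if j == i then A i :\ z else A j.
have B_sub z j : B z j \subset A j.
  by rewrite /B; case: eqP => [->|//]; rewrite subsetDl.
have IHB z : z \in A i -> (forall K : {set I},
  (#|K| <= r (\bigcup_(j in K) B z j)%SET)%N) ->
    exists x : I -> T, (forall i, x i \in A i) /\
    forall K : {set I}, (#|K| <= r (x @: K))%N.
  move=> zA hB; have [|w [wB hw]] := IH (B z) _ hB.
    rewrite -ltnS; apply: leq_ltn_trans le_n.
    rewrite (bigD1 i)//= [X in (_ < X)%N](bigD1 i)//= /B eqxx.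
    rewrite -addSn leq_add//; first by rewrite [X in (_ < X)%N](cardsD1 z) zA.
    by apply: leq_sum => j /negPf ->.
  by exists w; split=> // j; apply: (fintype.subsetP (B_sub z j)); exact: wB.
have [hBx|/existsNP[K hK]] := EM (forall K : {set I},
  (#|K| <= r (\bigcup_(j in K) B x j)%SET)%N).
  exact: IHB xA hBx.
have [hBy|/existsNP[L hL]] := EM (forall K : {set I},
  (#|K| <= r (\bigcup_(j in K) B y j)%SET)%N).
  exact: IHB yA hBy.
(* If [K] fails after deleting [x] and [L] after deleting [y], both contain [i]. As [x != y],
   [P :|: Q] contains all of [A i], so its rank is at least #|K :|: L|; and [P :&: Q] has rank at
   least #|K :&: L| - 1. Submodularity then contradicts r P + r Q <= #|K| + #|L| - 2. *)
exfalso.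
have memi z (M : {set I}) : ~ (#|M| <= r (\bigcup_(j in M) B z j)%SET)%N ->
  i \in M.
  move=> hM; apply/negP => iM; apply: hM; apply: (leq_trans (hA M)).
  apply: r_mono; apply/bigcupsP => j jM; apply: (bigcup_max j) => //.
  by rewrite /B; case: eqP => // ji; rewrite -ji jM in iM.
have iK := memi _ _ hK; have iL := memi _ _ hL.
move/negP: hK; rewrite -ltnNge => hK; move/negP: hL; rewrite -ltnNge => hL.
set P := (\bigcup_(j in K) _)%SET in hK; set Q := (\bigcup_(j in L) _)%SET in hL.
have hU : (#|K :|: L| <= r (P :|: Q))%N.
  apply: (leq_trans (hA _)); apply: r_mono; apply/bigcupsP => j jKL.
  apply/fintype.subsetP => z zA; rewrite inE.
  have [ji|nji] := eqVneq j i.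
    subst j; have [zx|zx] := eqVneq z x.
      apply/orP; right; apply/bigcupP; exists i => //.
      by rewrite /B eqxx !inE zA zx xy.
    apply/orP; left; apply/bigcupP; exists i => //.
    by rewrite /B eqxx !inE zA zx.
  have Bz w : z \in B w j by rewrite /B (negPf nji).
  by move: jKL; rewrite inE => /orP[jK|jL]; apply/orP; [left|right];
    apply/bigcupP; exists j.
have hI : (#|K :&: L :\ i| <= r (P :&: Q))%N.
  apply: (leq_trans (hA _)); apply: r_mono; apply/bigcupsP => j.
  rewrite !inE => /and3P[nji jK jL].
  apply/fintype.subsetP => z zA.
  have Bz w : z \in B w j by rewrite /B (negPf nji).
  by rewrite inE; apply/andP; split; apply/bigcupP; exists j.
have := r_submod P Q; have := cardsUI K L.
have := cardsD1 i (K :&: L); rewrite inE iK iL /=.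
by move: hK hL hU hI; lia.
Qed.

(** [F] collects the removed edges, not the kept ones: it is independent in the cographic matroid
    when [adj F] still connects all vertices. *)
Definition adj (G : graph) (F : {set edge G}) : rel (vertex G) :=
  fun a b => [exists e, (e \notin F) && (((src e == a) && (tgt e == b))
                                   || ((src e == b) && (tgt e == a)))].

Lemma adj_sym G F : symmetric (@adj G F).
Proof.
move=> a b; apply/existsP/existsP => -[e /andP[eF ab]]; exists e;
  by rewrite eF orbC.
Qed.

Lemma connect_adj_sym G F : connect_sym (@adj G F).
Proof. exact/sym_connect_sym/adj_sym. Qed.

Lemma adj0 G u v : connect (@adj G finset.set0) u v.
Proof.
apply: etrans (graph_connected u v); apply: eq_connect => a b.
by apply: eq_existsb => e; rewrite inE.
Qed.

Lemma adj_edge G (F : {set edge G}) e : e \notin F -> adj F (src e) (tgt e).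
Proof. by move=> eF; apply/existsP; exists e; rewrite eF !eqxx. Qed.

Lemma rank_sum_rows (K : fieldType) (I : finType) (S : {set I}) n
    (f : I -> 'rV[K]_n) : (\rank (\sum_(i in S) <<f i>>)%MS <= #|S|)%N.
Proof.
rewrite -sum1_card; elim/big_rec2: _ => [|i k A _ le_k]; first by rewrite mxrank0.
rewrite (leq_trans (mxrank_adds_leqif _ _))// leq_add//.
by rewrite genmxE rank_leq_row.
Qed.

(** * Rank of a graph with edges removed *)

Section Rank.
Variables (R : realType) (G : graph).
Implicit Types (F A B : {set edge G}) (u v : vertex G) (e : edge G).

Definition vrow v : 'rV[R]_#|vertex G| := delta_mx 0 (enum_rank v).
Definition brow e : 'rV[R]_#|vertex G| := row (enum_rank e) (boundary R G).

Lemma browE e : brow e = vrow (tgt e) - vrow (src e).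
Proof.
apply/rowP => j; rewrite !mxE /= enum_rankK.
by rewrite -!(inj_eq enum_val_inj) !enum_rankK ![enum_val j == _]eq_sym.
Qed.

(* The span of the edges outside F, so that rk F is the rank of G minus F. *)
Definition edge_span F : 'M[R]_#|vertex G| :=
  (\sum_(e | e \notin F) <<brow e>>)%MS.
Definition rk F : nat := \rank (edge_span F).

Lemma brow_sub F e : e \notin F -> (brow e <= edge_span F)%MS.
Proof. by move=> eF; rewrite (sumsmx_sup e)// genmxE. Qed.

Lemma edge_spanS A B : A \subset B -> (edge_span B <= edge_span A)%MS.
Proof.
move=> AB; apply/sumsmx_subP => e eB; rewrite genmxE brow_sub//.
by apply: contraNN eB; exact: (fintype.subsetP AB).
Qed.

(** The edges outside [A :&: B] span the sum of the two spans, and those outside [A :|: B] lie in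
    their intersection; the dimension formula for sum and intersection concludes. *)
Lemma rk_submod A B : (rk (A :|: B) + rk (A :&: B) <= rk A + rk B)%N.
Proof.
rewrite /rk -(mxrank_sum_cap (edge_span A)) addnC leq_add// mxrankS//.
  apply/sumsmx_subP => e; rewrite inE negb_and genmxE => /orP[eA|eB].
    by rewrite (submx_trans (brow_sub eA))// addsmxSl.
  by rewrite (submx_trans (brow_sub eB))// addsmxSr.
by rewrite sub_capmx !edge_spanS// ?finset.subsetUl ?finset.subsetUr.
Qed.

Lemma rk_setU A B : (rk A <= rk (A :|: B) + #|B|)%N.
Proof.
have : (edge_span A <= edge_span (A :|: B) + \sum_(e in B) <<brow e>>)%MS.
  apply/sumsmx_subP => e eA; rewrite genmxE; have [eB|eB] := boolP (e \in B).
    by rewrite (submx_trans _ (addsmxSr _ _))// (sumsmx_sup e)// genmxE.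
  by rewrite (submx_trans _ (addsmxSl _ _))// brow_sub// inE negb_or eA.
move=> /mxrankS /leq_trans; apply; rewrite (leq_trans (mxrank_adds_leqif _ _))//.
by rewrite leq_add2l rank_sum_rows.
Qed.

Lemma vrow_connect F u v : connect (adj F) u v ->
  (vrow v - vrow u <= edge_span F)%MS.
Proof.
case/connectP => p; elim: p u => [u _ ->|w p IH u /=].
  by rewrite subrr sub0mx.
move=> /andP[uw /IH{}IH /IH vw]; rewrite -(subrK (vrow w) (vrow v)) -addrA.
rewrite addmx_sub//; case/existsP: uw => e /andP[/brow_sub eF].
rewrite browE in eF => /orP[] /andP[/eqP <- /eqP <-] //.
by rewrite -opprB eqmx_opp.
Qed.

(** [S] meets every component left by [F], so modulo the edge span each basis vector equals the
    vector of some vertex of [S]: the span and #|S| further vectors generate the whole space. *)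
Lemma rk_roots F (S : {set vertex G}) :
  (forall v, exists2 u, u \in S & connect (adj F) u v) ->
  (#|vertex G| <= rk F + #|S|)%N.
Proof.
move=> hS; rewrite -[X in (X <= _)%N](@mxrank1 R).
have : ((1%:M : 'M[R]_#|vertex G|) <= edge_span F + \sum_(u in S) <<vrow u>>)%MS.
  apply/row_subP => i; rewrite row1 -[i]enum_valK.
  have [u uS uv] := hS (enum_val i); rewrite -[delta_mx _ _](subrK (vrow u)).
  apply: addmx_sub; first by rewrite (submx_trans _ (addsmxSl _ _))//
    vrow_connect.
  by rewrite (submx_trans _ (addsmxSr _ _))// (sumsmx_sup u)// genmxE.
move=> /mxrankS /leq_trans; apply; rewrite (leq_trans (mxrank_adds_leqif _ _))//.
by rewrite leq_add2l rank_sum_rows.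
Qed.

(** Functions constant on components give linear forms vanishing on the span. The constant 1 bounds
    the rank from above, and the indicator of a component detects disconnection. *)
Lemma edge_span_annihilate F (h : vertex G -> R) :
  (forall e, e \notin F -> h (src e) = h (tgt e)) ->
  (edge_span F <= kermx (\col_i h (enum_val i)))%MS.
Proof.
move=> hF; apply/sumsmx_subP => e eF; rewrite genmxE; apply/sub_kermxP.
rewrite browE mulmxBl -!rowE; apply/matrixP => i j; rewrite !mxE !enum_rankK.
by rewrite hF// subrr.
Qed.

Lemma rk_le F : (rk F < #|vertex G|)%N.
Proof.
have := @edge_span_annihilate F (fun=> 1) (fun _ _ => erefl).
move=> /mxrankS /leq_ltn_trans; apply; rewrite mxrank_ker.
rewrite ltn_subrL vertex_gt0 andbT; set c := (\col__ _).
rewrite lt0n mxrank_eq0; apply/eqP => /matrixP c0.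
have /card_gt0P[v _] := vertex_gt0 G.
by have := c0 (enum_rank v) 0; rewrite !mxE => /eqP; rewrite oner_eq0.
Qed.

Lemma rk0 : rk finset.set0 = #|vertex G|.-1.
Proof.
have := rk_le finset.set0; have /card_gt0P[v _] := vertex_gt0 G.
have := @rk_roots finset.set0 [set v]; rewrite cards1 => /(_ _)/wrap[u|].
  by exists v; rewrite ?inE// adj0.
lia.
Qed.

(** Rank-nullity for the boundary map, whose rank is #|vertex G| - 1 because the graph is
    connected. *)
Lemma genusE : (genus R G + #|vertex G| = #|edge G| + 1)%N.
Proof.
rewrite /genus mxrank_ker.
have rkE : \rank (boundary R G) = rk finset.set0.
  apply/eqP; rewrite eqn_leq; apply/andP; split; apply: mxrankS.
    by apply/row_subP => i; rewrite -[i]enum_valK brow_sub ?inE.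
  by apply/sumsmx_subP => e _; rewrite genmxE row_sub.
have := rank_leq_row (boundary R G); have := vertex_gt0 G.
by rewrite rkE rk0; lia.
Qed.

(** At full rank the span equals that of the whole graph, hence contains [vrow v - vrow u]. If [v]
    were outside the component of [u], the indicator of that component would vanish on the span but
    not on this vector. *)
Lemma rk_connected F : (#|vertex G|.-1 <= rk F)%N -> forall u v,
  connect (adj F) u v.
Proof.
move=> hF u v; apply: contraT => uv.
have eqF : (edge_span finset.set0 <= edge_span F)%MS.
  rewrite -(mxrank_leqif_sup (edge_spanS (finset.sub0set F))) eqn_leq.
  by rewrite -/(rk _) -/(rk _) rk0 hF andbT -ltnS prednK ?vertex_gt0// rk_le.
have := submx_trans (vrow_connect (adj0 u v)) eqF.
move=> /submx_trans/(_ (@edge_span_annihilate F (fun w =>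
  (connect (adj F) u w)%:R) _)).
move=> /(_ _)/wrap[e eF|/sub_kermxP].
  have := @same_connect_r _ _ (@connect_adj_sym G F) _ _ (connect1 (adj_edge eF))
    u.
  by move=> /= ->.
rewrite mulmxBl -!rowE => /matrixP/(_ 0 0); rewrite !mxE !enum_rankK (negPf uv).
by rewrite connect0 => /eqP; rewrite sub0r oppr_eq0 oner_eq0.
Qed.

End Rank.

(** * Chip firing *)

Lemma finite_argmin (T : Type) (A : set T) (g : T -> int) :
  finite_set A -> (A !=set0)%classic ->
  exists2 x, A x & forall y, A y -> g x <= g y.
Proof.
move=> /(finite_image g) /finite_seqP[s gA] [a0 Aa0].
have mem_s y : A y -> g y \in s by move=> Ay; suff :
  [set` s]%classic (g y) by []; rewrite -gA; exists y.
suff [m ms hm] : exists2 m, m \in s & forall z, z \in s -> m <= z.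
  have : [set` s]%classic m by [].
  by rewrite -gA => -[x Ax xm]; exists x => // y /mem_s; rewrite xm; exact: hm.
have : s != [::] by apply/eqP => s0; have := mem_s _ Aa0; rewrite s0.
elim: s {gA mem_s} => // x s IH _; have [->|/IH[m ms hm]] := eqVneq s [::].
  by exists x => [|z]; rewrite inE// => /eqP ->.
have [xm|mx] := leP x m.
  exists x => [|z]; rewrite inE ?eqxx// => /orP[/eqP ->//|/hm].
  exact: le_trans.
exists m => [|z]; rewrite inE ?ms ?orbT// => /orP[/eqP ->|/hm//].
exact: ltW.
Qed.

Section ChipFiring.
Variable G : graph.
Implicit Types (f h : vertex G -> int) (v : vertex G) (e : edge G).

(** The graph Laplacian: [D0 - lap f] is what remains of [D0] when each [v] fires [f v] times. A
    loop occurs in both sums and contributes zero. *)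
Definition lap f v : int :=
  \sum_(e | src e == v) (f v - f (tgt e)) + \sum_(e | tgt e == v) (f v - f (src
    e)).

Lemma sum_fiber (V : nmodType) (I J : finType) (p : I -> J) (F : I -> J -> V) :
  \sum_j \sum_(i | p i == j) F i j = \sum_i F i (p i).
Proof.
rewrite (exchange_big_dep xpredT)//=; apply: eq_bigr => i _.
by rewrite (eq_bigl (pred1 (p i))) ?big_pred1_eq// => j /=; rewrite eq_sym.
Qed.

(** Summation by parts: the right-hand side is the Dirichlet form of [f] and [h]. *)
Lemma lap_green f h : \sum_v h v * lap f v =
  \sum_e (f (src e) - f (tgt e)) * (h (src e) - h (tgt e)).
Proof.
under eq_bigr do rewrite mulrDr !mulr_sumr.
rewrite big_split/= !sum_fiber -big_split/=.
by apply: eq_bigr => e _; ring.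
Qed.

Lemma sum_lap f : \sum_v lap f v = 0.
Proof.
have := lap_green f (fun=> 1); under eq_bigr do rewrite mul1r.
by move=> ->; apply: big1 => e _; rewrite subrr mulr0.
Qed.

Lemma lapD f h v : lap (fun w => f w + h w) v = lap f v + lap h v.
Proof.
rewrite /lap addrACA -!big_split/=; congr (_ + _); apply: eq_bigr => e _; ring.
Qed.

Lemma lapN f v : lap (fun w => - f w) v = - lap f v.
Proof.
rewrite /lap opprD -!sumrN; congr (_ + _); apply: eq_bigr => e _; ring.
Qed.

(** A harmonic function has zero Dirichlet energy, hence agrees at the two ends of every edge and is
    constant by connectedness. *)
Lemma lap_inj f q : (forall v, lap f v = 0) -> f q = 0 -> forall v, f v = 0.
Proof.
move=> lap0 fq; have /eqP : \sum_e (f (src e) - f (tgt e)) ^+ 2 = 0.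
  under eq_bigr do rewrite expr2; rewrite -lap_green big1// => v _.
  by rewrite lap0 mulr0.
rewrite psumr_eq0 => [/allP df0|e _]; last exact: sqr_ge0.
have df e : f (src e) = f (tgt e).
  by have := df0 e (mem_index_enum _); rewrite sqrf_eq0 subr_eq0 => /eqP.
move=> v; rewrite -fq; have /connectP[p] := adj0 v q.
elim: p v => [v _ ->//|w p IH v] /= /andP[/existsP[e /andP[_ he]] /IH{}IH /IH <-].
by case/orP: he => /andP[/eqP <- /eqP <-].
Qed.

Variable D0 : vertex G -> int.

(* Twice the energy of D0 - lap f relative to half the canonical divisor. *)
Definition energy f : int :=
  \sum_e ((f (src e) - f (tgt e)) ^+ 2 + f (src e) + f (tgt e))
  - 2 * \sum_v f v * (D0 v + 1).

(** The increment is the energy of [h] relative to the current divisor [D0 - lap f] in place of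
    [D0]: the cross terms of the squares become [h v * lap f v] by [lap_green]. *)
Lemma energyD f h : energy (fun v => f v + h v) = energy f
  + \sum_e ((h (src e) - h (tgt e)) ^+ 2 + h (src e) + h (tgt e))
  - 2 * \sum_v h v * (D0 v - lap f v + 1).
Proof.
have -> : \sum_v h v * (D0 v - lap f v + 1) = \sum_v h v * (D0 v + 1) -
   \sum_e (f (src e) - f (tgt e)) * (h (src e) - h (tgt e)).
  by rewrite -lap_green -sumrB; apply: eq_bigr => v _; ring.
have hD : \sum_v (f v + h v) * (D0 v + 1) =
    \sum_v f v * (D0 v + 1) + \sum_v h v * (D0 v + 1).
  by rewrite -big_split/=; apply: eq_bigr => v _; ring.
rewrite /energy /= hD.
have -> : \sum_e ((f (src e) + h (src e) - (f (tgt e) + h (tgt e))) ^+ 2 +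
    (f (src e) + h (src e)) + (f (tgt e) + h (tgt e))) =
  \sum_e ((f (src e) - f (tgt e)) ^+ 2 + f (src e) + f (tgt e)) +
  \sum_e ((h (src e) - h (tgt e)) ^+ 2 + h (src e) + h (tgt e)) +
  2 * \sum_e (f (src e) - f (tgt e)) * (h (src e) - h (tgt e)).
  by rewrite mulr_sumr -!big_split/=; apply: eq_bigr => e _; ring.
ring.
Qed.

Definition feasible q : set (vertex G -> int) :=
  [set f | f q = 0 /\ forall v, 0 <= D0 v - lap f v]%classic.

(** The values of an effective divisor lie between 0 and its degree, and the normalization [f q = 0]
    makes [f] recoverable from [D0 - lap f] by [lap_inj]. *)
Lemma feasible_finite q : finite_set (feasible q).
Proof.
pose d := absz (\sum_v D0 v).
have le_d f v : feasible q f -> D0 v - lap f v <= d%:Z.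
  case=> _ f0; have : \sum_w (D0 w - lap f w) = \sum_v D0 v.
    by rewrite sumrB sum_lap subr0.
  rewrite (bigD1 v)//= => s; have s_ge0 : 0 <= \sum_(i | i != v) (D0 i - lap f i).
    exact: sumr_ge0.
  by rewrite /d -s gez0_abs ?lerDl// addr_ge0.
pose E f := [ffun v => inord (absz (D0 v - lap f v))] : {ffun vertex G ->
  'I_d.+1}.
have E_inj : {in feasible q &, injective E}.
  move=> f h /set_mem ff /set_mem fh /ffunP Efh; apply/funext => v.
  have eqE w : D0 w - lap f w = D0 w - lap h w.
    have := congr1 (@nat_of_ord _) (Efh w); rewrite !ffunE.
    have := le_d f w ff; have := le_d h w fh.
    case: ff fh => _ /(_ w) f0 [_ /(_ w) h0] lef leh.
    by rewrite !inordK; lia.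
  apply/eqP; rewrite -subr_eq0; apply/eqP.
  apply: (@lap_inj (fun v => f v - h v) q) => [w|];
    last by rewrite ff.1 fh.1 subrr.
  by have := eqE w; rewrite lapD lapN; lia.
by rewrite -(eq_finite_set (inj_card_eq E_inj)); exact: finite_finset.
Qed.

Lemma feasible_min q : (forall v, 0 <= D0 v) ->
  exists2 f, feasible q f & forall h, feasible q h ->
    energy f <= energy h /\ (energy h = energy f -> \sum_v f v <= \sum_v h v).
Proof.
move=> D0_ge0.
have [|g fg ming] := finite_argmin energy (feasible_finite q).
  exists (fun=> 0); split=> // v; suff -> : lap (fun=> 0) v = 0 by rewrite subr0.
  by rewrite /lap !big1 ?addr0// => e _; rewrite subrr.
have [||f [ff Ef] minf] := @finite_argmin _
    [set h | feasible q h /\ energy h = energy g]%classic (fun h => \sum_v h v).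
- by apply: sub_finite_set (feasible_finite q) => h [].
- by exists g.
exists f => // h fh; split; first by rewrite Ef; exact: ming.
by move=> Eh; apply: minf; split=> //; rewrite Eh.
Qed.

End ChipFiring.

(** * Rado's condition for an energy-minimizing divisor *)

Section Balanced.
Variables (R : realType) (G : graph).
Implicit Types (S C : {set vertex G}) (v s : vertex G) (e : edge G)
  (E : vertex G -> int).

Definition touch S : {set edge G} := [set e | (src e \in S) || (tgt e \in S)].
Definition inside C : {set edge G} := [set e | (src e \in C) && (tgt e \in C)].
Definition joining s C : {set edge G} :=
  [set e | ((src e == s) && (tgt e \in C)) || ((tgt e == s) && (src e \in C))].

(* Rado's condition at S: the edges touching S have rank at least E(S) in the
   cographic matroid, whose rank function is #|F| + rk F + 1 - #|vertex G|. *)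
Definition balanced E S : Prop :=
  \sum_(v in S) E v + #|vertex G|%:Z <= (#|touch S| + rk R (touch S) + 1)%N%:Z.

(** Removing the edges touching [S] isolates the vertices of [S], so the classes outside [S] are the
    components of the graph with [S] deleted. *)
Lemma connect_touch S u v : connect (adj (touch S)) u v -> u \notin S ->
  v \notin S.
Proof.
case/connectP => p; elim: p u => [u _ ->//|w p IH u] /= /andP[uw /IH{}IH /IH{}IH].
move=> _; apply: IH; case/existsP: uw => e; rewrite inE negb_or.
by move=> /andP[/andP[sS tS] /orP[]/andP[/eqP h1 /eqP h2]]; rewrite -?h1 -?h2.
Qed.

Section Component.
Variables (S : {set vertex G}) (r : vertex G).
Hypothesis rS : r \notin S.
Let C := [set v | connect (adj (touch S)) r v].

Lemma component_notin v : v \in C -> v \notin S.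
Proof. by rewrite inE => /connect_touch; apply. Qed.

Lemma component_joining v : v \notin S -> v \notin C -> joining v C = finset.set0.
Proof.
move=> vS vC; apply/setP => e; rewrite !inE; apply/negP => he.
suff : v \in C by rewrite (negPf vC).
rewrite inE; case/orP: he => /andP[/eqP ev er]; apply: (connect_trans er).
  rewrite connect_adj_sym -ev; apply: connect1; apply: adj_edge.
  by rewrite inE negb_or ev vS; apply: component_notin; rewrite inE.
rewrite -ev; apply: connect1; apply: adj_edge.
by rewrite inE negb_or ev vS andbT; apply: component_notin; rewrite inE.
Qed.

(* Adding the edges from s to C to the complement of touch S only merges the
   class of s with that of C, so it raises the rank by at most one. *)
Lemma rk_joining s : s \in S -> (rk R (touch S :\:
  joining s C) <= rk R (touch S) + 1)%N.
Proof.
move=> sS; have [->|[e0 e0J]] := finset.set_0Vmem (joining s C).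
  by rewrite finset.setD0 leq_addr.
have end_of e : e \in joining s C -> exists2 x, x \in C &
    brow R e = vrow R x - vrow R s \/ brow R e = - (vrow R x - vrow R s).
  rewrite inE browE => /orP[] /andP[/eqP <- xC].
    by exists (tgt e); last left.
  by exists (src e); last by right; rewrite opprB.
have [x0 x0C e0E] := end_of _ e0J.
have : (edge_span R (touch S :\: joining s C) <= edge_span R (touch S) + brow R
  e0)%MS.
  apply/sumsmx_subP => e; rewrite genmxE inE negb_and negbK => /orP[eJ|eS].
    have [x xC eE] := end_of _ eJ.
    have x0x : (vrow R x - vrow R x0 <= edge_span R (touch S) + brow R e0)%MS.
      rewrite (submx_trans _ (addsmxSl _ _))// vrow_connect//.
      rewrite !inE in xC x0C.
      by rewrite (connect_trans _ xC)// connect_adj_sym.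
    have x0s : (vrow R x0 - vrow R s <= edge_span R (touch S) + brow R e0)%MS.
      rewrite (submx_trans _ (addsmxSr _ _))//.
      by case: e0E => ->; rewrite ?eqmx_opp.
    have xs : (vrow R x - vrow R s <= edge_span R (touch S) + brow R e0)%MS.
      by rewrite -(subrK (vrow R x0) (vrow R x)) -addrA addmx_sub.
    by case: eE => -> //; rewrite eqmx_opp.
  by rewrite (submx_trans _ (addsmxSl _ _))// brow_sub.
move=> /mxrankS /leq_trans; apply; rewrite (leq_trans (mxrank_adds_leqif _ _))//.
by rewrite leq_add// rank_leq_row.
Qed.

(** This is what lets [C] borrow one chip along each edge without putting [s] into debt. By
    [rk_joining] and [rk_setU], the cographic rank of the touching edges grows by at least #|N| - 1
    from [S :\ s] to [S]; since the condition holds at the first set and fails at the second, [E s]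
    exceeds that growth. *)
Lemma joining_le E s : 0 <= E s -> s \in S -> ~ balanced E S ->
  balanced E (S :\ s) ->
  #|joining s C|%:Z <= E s.
Proof.
move=> Es sS /negP; rewrite -ltNge /balanced => vS bS.
set N := joining s C; set F := touch S; set F' := touch (S :\ s).
have xS e : e \in N -> (e \in F) && (e \notin F').
  rewrite !inE => /orP[] /andP[/eqP -> /connect_touch/(_ rS) xS];
    rewrite eqxx sS /=.
    by rewrite ?orbT negb_and xS orbT.
  by rewrite orbT/= orbF negb_and xS orbT.
have NF : N \subset F by apply/fintype.subsetP => e /xS /andP[].
have F'F : F' \subset F :\: N.
  apply/fintype.subsetP => e eF'; rewrite inE; apply/andP; split.
    by apply/negP => /xS; rewrite eF' andbF.
  by move: eF'; rewrite !inE => /orP[]/andP[_ ->]; rewrite ?orbT.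
have := rk_setU R F' ((F :\: N) :\: F'); 
rewrite -{2}(finset.setIidPr F'F) finset.setID => rk1.
have := rk_joining sS; rewrite -/N -/F => rk2.
have c1 := cardsD F N; rewrite (finset.setIidPr NF) in c1.
have c2 := cardsD (F :\: N) F'; rewrite (finset.setIidPr F'F) in c2.
have := subset_leq_card NF; have := subset_leq_card F'F.
move: bS vS; rewrite (big_setD1 s sS)/= -/F -/F'.
set x := \sum_(_ in _) _; lia.
Qed.

Lemma lap_indicator v : lap (fun w => (w \in C)%:Z) v =
  if v \in C then (#|[set e | (src e == v) && (tgt e \notin C)]| +
                   #|[set e | (tgt e == v) && (src e \notin C)]|)%N%:Z
  else - #|joining v C|%:Z.
Proof.
have card_sum (P Q : pred (edge G)) :
    \sum_(e | P e) (Q e)%:Z = #|[set e | P e && Q e]|%:Z.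
  rewrite -[RHS]natz -sum1_card natr_sum/= big_mkcond [RHS]big_mkcond/=.
  by apply: eq_bigr => e _; rewrite inE; case: (P e); case: (Q e).
rewrite /lap; case: ifPn => vC.
  rewrite PoszD -!card_sum; congr (_ + _); apply: eq_bigr => e _;
  by case: (_ \in C).
have -> : #|joining v C|%:Z = #|[set e | (src e == v) && (tgt e \in C)]|%:Z +
     #|[set e | (tgt e == v) && (src e \in C)]|%:Z.
  rewrite -PoszD; congr Posz; rewrite -cardsUI.
  rewrite [_ :&: _](_ : _ = finset.set0) ?cards0 ?addn0.
    by apply: eq_card => e; rewrite !inE.
  apply/setP => e; rewrite !inE; apply/negP =>
    /andP[/andP[_ tC] /andP[/eqP tv _]].
  by move: vC; rewrite -tv inE tC.
by rewrite -!card_sum opprD -!sumrN; congr (_ + _); apply: eq_bigr => e _;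
  rewrite sub0r.
Qed.

End Component.

Section Components.
Variable S : {set vertex G}.
Let rt := fingraph.root (adj (touch S)).
(** Each component of the graph with [S] deleted is represented by its canonical root; the isolated
    classes formed by the vertices of [S] are left out. *)
Definition component_roots : {set vertex G} := [set r | (r \notin S) &&
  (rt r == r)].
Definition component r : {set vertex G} := [set v | connect (adj (touch S)) r v].

Let rt_notin v : (rt v \notin S) = (v \notin S).
Proof.
apply/idP/idP; first by move=> /(connect_touch _); apply;
  rewrite connect_adj_sym connect_root.
by apply: connect_touch; exact: connect_root.
Qed.

Let rt_component r v : r \in component_roots -> (v \in component r) = (rt v == r).
Proof.
rewrite !inE => /andP[_ /eqP rr]; rewrite -{2}rr connect_adj_sym.
by rewrite -(root_connect (@connect_adj_sym _ _)).
Qed.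

Let rt_root v : v \notin S -> rt v \in component_roots.
Proof.
by move=> vS; rewrite inE rt_notin vS; apply/eqP; exact:
  (root_root (@connect_adj_sym _ _)).
Qed.

Lemma sum_components (h : vertex G -> int) : \sum_v h v =
  \sum_(v in S) h v + \sum_(r in component_roots) \sum_(v in component r) h v.
Proof.
rewrite (bigID (mem S))/=; congr (_ + _).
rewrite (partition_big rt (mem component_roots))/=; last exact: rt_root.
apply: eq_bigr => r rR; apply: eq_bigl => v; rewrite rt_component//.
apply/andP/idP => [[_ ->//]|/eqP vr]; split; last exact/eqP.
by rewrite -rt_notin vr; move: rR; rewrite inE => /andP[].
Qed.

(** An edge that does not touch [S] joins two vertices of the same component, so it is counted
    inside exactly one. *)
Lemma card_inside_components : #|edge G|%:Z =
  #|touch S|%:Z + \sum_(r in component_roots) #|inside (component r)|%:Z.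
Proof.
rewrite -(cardsC (touch S)) PoszD; congr (_ + _).
rewrite -[LHS]natz -sum1_card natr_sum/=.
rewrite (partition_big (rt \o @src G) (mem component_roots))/=; last first.
  by move=> e; rewrite !inE negb_or => /andP[sS _]; have := rt_root sS;
    rewrite inE.
apply: eq_bigr => r rR; rewrite -natr_sum sum1_card natz; congr Posz.
apply: eq_card => e; rewrite [RHS]inE !rt_component// unfold_in /= inE /=.
apply/andP/andP => [[eS er]|[/eqP sr /eqP tr]].
  split=> //; rewrite -(eqP er).
  by rewrite /rt (root_connect (@connect_adj_sym _ _)) connect_adj_sym connect1//
    adj_edge.
rewrite sr eqxx inE negb_or -(rt_notin (src e)) sr -(rt_notin (tgt e)) tr.
by move: rR; rewrite inE => /andP[->].
Qed.

Lemma rk_components : (#|vertex G| <= rk R (touch S) + #|S| +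
  #|component_roots|)%N.
Proof.
rewrite -addnA; apply: leq_trans (leq_add (leqnn _) (leq_card_setU _ _)).
apply: rk_roots => v; have [vS|vS] := boolP (v \in S).
  by exists v; rewrite ?inE ?vS ?connect0.
exists (rt v); first by rewrite inE rt_root// orbT.
by rewrite connect_adj_sym connect_root.
Qed.

End Components.

Lemma balanced_divisor (D0 : vertex G -> int) :
  (forall v, 0 <= D0 v) -> \sum_v D0 v <= (genus R G)%:Z ->
  exists2 f, (forall v, 0 <= D0 v - lap f v) &
    forall S, balanced (fun v => D0 v - lap f v) S.
Proof.
move=> D0_ge0 D0_le; have /card_gt0P[q _] := vertex_gt0 G.
have [f [fq E_ge0] minf] := feasible_min q D0_ge0.
exists f => //; set E := fun v => _.
have sumE : \sum_v E v = \sum_v D0 v by rewrite sumrB sum_lap subr0.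
move=> S0; apply: contrapT => /asboolPn vS0.
(* Take a minimal violating [S]: Rado's condition then holds at every [S :\ s], as [joining_le]
   requires. *)
have [S /minsetP[/asboolPn vS minS] _] :=
  @minset_exists _ (fun S => ~~ `[<balanced E S>]) S0 vS0.
have {}minS s : s \in S -> balanced E (S :\ s).
  move=> sS; apply: contrapT => nb; have := minS (S :\ s).
  rewrite subD1set => /(_ _ isT)/wrap[|eS]; first exact/asboolPn.
  by move: sS; rewrite -eS !inE eqxx.
have sumE1 : \sum_v (E v + 1) = \sum_v E v + #|vertex G|%:Z.
  by rewrite big_split/= sumr_const natz.
pose Rt := component_roots S.
(* [t r] is the genus of the component minus the number of chips on it. *)
pose t r := #|inside (component S r)|%:Z + 1 - \sum_(v in component S r) (E v +
  1).
(* By [genusE] the left-hand side is the genus plus one minus the degree, so it is at least 1. The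
   bound combines the violation at [S] with the rank bound [rk_components]. *)
have sum_t : #|edge G|%:Z - \sum_v E v - #|vertex G|%:Z + 2 <= \sum_(r in Rt) t r.
  have -> : \sum_(r in Rt) t r = \sum_(r in Rt) #|inside (component S r)|%:Z +
     #|Rt|%:Z - \sum_(r in Rt) \sum_(v in component S r) (E v + 1).
    by rewrite sumrB big_split/= sumr_const natz.
  have := card_inside_components S; have := sum_components S (fun v => E v + 1).
  rewrite sumE1 [\sum_(v in S) (_ + 1)]big_split/= sumr_const natz -/Rt.
  have := rk_components S; rewrite -/Rt.
  move: vS; rewrite /balanced => /negP; rewrite -ltNge.
  set a := \sum_(_ in Rt) _; set b := \sum_(_ in Rt) _; set c := \sum_(_ in S) _.
  lia.
have t_pos : 0 < \sum_(r in Rt) t r.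
  by apply: lt_le_trans sum_t; rewrite sumE; have := genusE R G; lia.
(* When a component borrows, its own vertices only gain, those of [S] can pay by [joining_le], and
   the remaining ones have no edge to it. *)
have borrow r : r \in Rt -> forall v, 0 <= E v + lap (fun w =>
  (w \in component S r)%:Z) v.
  rewrite inE => /andP[rS _] v; rewrite lap_indicator//; case: ifPn => vC.
    by apply: addr_ge0; first exact: E_ge0.
  rewrite subr_ge0; have [vS'|vS'] := boolP (v \in S).
    by exact: (joining_le rS (E_ge0 v) vS' vS (minS _ vS')).
  by rewrite component_joining// cards0; exact: E_ge0.
have r_in r : r \in component S r by rewrite inE connect0.
(* Borrowing by a component without [q] changes the energy by [2 * (1 - t r)], which is at most 0.
   Minimality forces [t r = 1], and then the sum of [f] would drop by the size of the component. *)
have [[r rR /andP[tr qr]]|nor] := EM (exists2 r, r \in Rt & (0 < t r) &&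
  (q \notin component S r)).
  have /minf[le_en] : feasible D0 q (fun v => f v + - (v \in component S r)%:Z).
    split; first by rewrite fq (negPf qr).
    by move=> v; rewrite lapD lapN opprD opprK addrA; exact: borrow.
  have : energy D0 (fun v => f v + - (v \in component S r)%:Z) =
      energy D0 f + 2 * (1 - t r).
    rewrite energyD -!addrA; congr (_ + _).
    have -> : \sum_e ((- (src e \in component S r)%:Z - - (tgt e \in component S
      r)%:Z) ^+ 2
        - (src e \in component S r)%:Z - (tgt e \in component S r)%:Z) =
        - (2 * #|inside (component S r)|%:Z).
      rewrite -[#|_|%:Z]natz -sum1_card natr_sum mulr_sumr -sumrN
        [RHS]big_mkcond/=.
      apply: eq_bigr => e _; rewrite /inside [in RHS]inE.
      by case: (src e \in _); case: (tgt e \in _).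
    have -> : \sum_v - (v \in component S r)%:Z * (D0 v - lap f v + 1) =
        - \sum_(v in component S r) (E v + 1).
      rewrite -sumrN [RHS]big_mkcond/=; apply: eq_bigr => v _.
      by case: (_ \in _); rewrite ?mulN1r ?oppr0 ?mul0r.
    rewrite /t; ring.
  move=> en_eq; rewrite en_eq in le_en *; have t1 : t r = 1 by lia.
  rewrite t1 subrr mulr0 addr0 => /(_ erefl).
  rewrite sumrB lerDl oppr_ge0; apply/negP; rewrite -ltNge.
  rewrite (bigD1 r)//= r_in ltr_pwDl// sumr_ge0//.
have [r rR tr] : exists2 r, r \in Rt & 0 < t r.
  apply: contrapT => hr; move: t_pos; apply/negP; rewrite -leNgt.
  by apply: sumr_le0 => r rR; rewrite leNgt; apply/negP => tr; apply: hr;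
    exists r.
have qr : q \in component S r.
  by apply: contrapT => /negP qr; apply: nor; exists r; rewrite ?tr.
(* Every component other than that of [q] now has [t w <= 0]. *)
have le_tr : \sum_(w in Rt) t w <= t r.
  rewrite (bigD1 r)//= gerDl; apply: sumr_le0 => w /andP[wR wr].
  rewrite leNgt; apply/negP => tw; apply: nor; exists w => //; rewrite tw /=.
  apply: contra wr => qw; move: wR rR qw qr; rewrite !inE =>
    /andP[_ /eqP ww] /andP[_ /eqP rr].
  move=> /(fingraph.rootP (@connect_adj_sym _ _)) + /(fingraph.rootP
    (@connect_adj_sym _ _)).
  by rewrite ww rr => -> ->.
(* Firing the complement has the same effect on the divisor as borrowing by the component, the two
   functions differing by a constant, but it keeps the value 0 at [q]. *)
have /minf[le_en _] : feasible D0 q (fun v => f v + (v \notin component S r)%:Z).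
  split; first by rewrite fq qr.
  move=> v; have -> : lap (fun w => f w + (w \notin component S r)%:Z) v =
      lap (fun w => f w + - (w \in component S r)%:Z) v.
    rewrite /lap; congr (_ + _); apply: eq_bigr => e _; do 2!case: (_ \in _) =>
      /=; ring.
  by rewrite lapD lapN opprD opprK addrA; exact: borrow.
(* The energy changes by twice #|edge G| - deg E - #|vertex G| + 1 - t r, which is at most -2 by
   [sum_t] and [le_tr]. *)
move: le_en; apply/negP; rewrite -ltNge energyD.
have -> : \sum_e (((src e \notin component S r)%:Z - (tgt e \notin component S
  r)%:Z) ^+ 2
        + (src e \notin component S r)%:Z + (tgt e \notin component S r)%:Z) =
    2 * (#|edge G|%:Z - #|inside (component S r)|%:Z).
  rewrite -(cardsC (inside (component S r))) PoszD addrAC subrr add0r.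
  rewrite -[#|_|%:Z]natz -sum1_card natr_sum mulr_sumr [RHS]big_mkcond/=.
  apply: eq_bigr => e _; rewrite /inside [in RHS]inE [in RHS]inE.
  by case: (src e \in _); case: (tgt e \in _).
have -> : \sum_v (v \notin component S r)%:Z * (D0 v - lap f v + 1) =
    \sum_v (E v + 1) - \sum_(v in component S r) (E v + 1).
  rewrite [in RHS](bigID (mem (component S r)))/= addrAC subrr add0r
    [RHS]big_mkcond/=.
  by apply: eq_bigr => v _; case: (_ \in _); rewrite ?mul1r ?mul0r.
rewrite sumE1; move: sum_t le_tr; rewrite /t; lia.
Qed.

End Balanced.

(** * Assigning chips to edges, and spanning trees *)

Section Orientation.
Variables (R : realType) (G : graph).
Implicit Types (F : {set edge G}) (v : vertex G) (e : edge G).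

(** Rado's theorem with one index per chip, the candidates for a chip being the edges at its vertex.
    [X] is the set of chosen edges, and [hd] sends each of them to the vertex of its chip. *)
Lemma balanced_orientation (E : vertex G -> int) :
  (forall v, 0 <= E v) -> (forall S, balanced R E S) ->
  exists (X : {set edge G}) (hd : edge G -> vertex G),
    [/\ forall v, E v = #|[set e in X | hd e == v]|%:Z,
        forall e, hd e = src e \/ hd e = tgt e &
        forall u v, connect (adj X) u v].
Proof.
move=> E_ge0 balE; pose I := {v : vertex G & 'I_(absz (E v))}.
have cardI (S : {set vertex G}) : #|[set i : I | tag i \in S]|%:Z = \sum_(v in S)
  E v.
  rewrite -[LHS]natz -sum1_card natr_sum.
  rewrite (eq_bigl (fun i : I => (tag i \in S) && true)); last first.
    by move=> i; rewrite inE andbT.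
  rewrite -(@sig_big_dep _ _ _ _ _ (mem S) (fun _ _ => true) (fun _ _ => 1))/=.
  by apply: eq_bigr => v _; rewrite sumr_const card_ord natz gez0_abs.
(* The rank function of the cographic matroid; [r_ge] shows that the truncated subtraction is
   exact. *)
pose r (B : {set edge G}) := ((#|B| + rk R B).+1 - #|vertex G|)%N.
have r_ge (B : {set edge G}) : (#|vertex G| <= (#|B| + rk R B).+1)%N.
  have := rk_setU R finset.set0 B; rewrite finset.set0U rk0.
  by have := vertex_gt0 G; lia.
have [||||x [xA hx]] := @rado_transversal I _ r _ _ _ (fun i =>
  touch [set tag i]).
- by rewrite /r cards0 rk0; have := vertex_gt0 G; lia.
- move=> A B AB; rewrite /r leq_sub2r// ltnS.
  have := rk_setU R A (B :\: A).
  rewrite -{2}(finset.setIidPr AB) finset.setID cardsD (finset.setIidPr AB).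
  by have := subset_leq_card AB; lia.
- move=> A B; have := rk_submod R A B; have := cardsUI A B; rewrite /r.
  have := r_ge A; have := r_ge B; have := r_ge (A :|: B); have := r_ge (A :&: B).
  lia.
- move=> K; have -> : (\bigcup_(i in K) touch [set tag i])%SET = touch (tag @: K).
    apply/setP => e; apply/bigcupP/idP => [[i iK]|].
      rewrite inE !finset.in_set1 => eT; rewrite inE.
      by case/orP: eT => /eqP eT; rewrite eT imset_f ?orbT.
    by rewrite inE => /orP[]/imsetP[i iK ei]; exists i => //;
      rewrite !inE ei eqxx ?orbT.
  have : (#|K| <= #|[set i : I | tag i \in tag @: K]|)%N.
    by apply/subset_leq_card/fintype.subsetP => i iK; rewrite inE imset_f.
  have := balE (tag @: K); rewrite /balanced -cardI /r; lia.
(* Since [r] is bounded by the cardinality, by [rk_le], the Rado bound for all indices together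
   forces distinct edges. *)
have x_inj : injective x.
  have /imset_injP xT : #|x @: [set: I]%SET| == #|[set: I]%SET|.
    rewrite eqn_leq leq_imset_card/=.
    apply: (leq_trans (hx _)); rewrite leq_subLR -addnS addnC leq_add2r.
    exact: rk_le.
  by move=> i j; apply: xT; rewrite finset.inE.
pose X := x @: [set: I]%SET.
have connX u v : connect (adj X) u v.
  (* For empty [X] the bound on the truncated [r X] carries no information, so this case is settled
     apart. *)
  have [I0|X_gt0] := posnP #|X|.
    by rewrite (cards0_eq I0) adj0.
  apply: (@rk_connected R); have := hx [set: I]%SET;
    rewrite -(card_imset _ x_inj).
  by move: X_gt0; rewrite /r -/X; move: #|X| (rk R X) => a b; lia.
pose hd e := if [pick i | x i == e] is Some i then tag i else src e.
have hd_x i : hd (x i) = tag i.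
  by rewrite /hd; case: pickP => [j /eqP/x_inj ->//|/(_ i)]; rewrite eqxx.
exists X, hd; split=> // [v|e]; last first.
  rewrite /hd; case: pickP => [i /eqP <-|_]; last by left.
  by have := xA i; rewrite !inE => /orP[]/eqP ->; [left|right].
have := cardI [set v]; rewrite big_set1 => <-; congr Posz.
rewrite -(card_imset _ x_inj); apply: eq_card => e; rewrite !inE.
apply/imsetP/andP => [[i iv ->]|[/imsetP[i _ ->]]].
  by rewrite hd_x imset_f//; move: iv; rewrite !inE.
by rewrite hd_x => iv; exists i; rewrite ?inE.
Qed.

(** A breadth-first tree: [depth] is the distance from [rho], and [par] gives the last step of a
    shortest path. Only the values of [par] away from [rho] are meaningful. *)
Lemma spanning_tree F (rho : vertex G) : (forall u v, connect (adj F) u v) ->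
  exists (depth : vertex G -> nat) (par : vertex G -> option (vertex G * edge G)),
    depth rho = 0%N /\ forall v, v != rho -> exists u e,
      [/\ par v = Some (u, e), e \notin F, depth v = (depth u).+1 &
        (src e = u /\ tgt e = v) \/ (tgt e = u /\ src e = v)].
Proof.
move=> connF.
pose P v n := [exists p : n.-tuple (vertex G), path (adj F) rho p &&
  (last rho p == v)].
have exP v : exists n, P v n.
  have /connectP[p pp ->] := connF rho v.
  by exists (size p); apply/existsP; exists (in_tuple p); rewrite /= pp eqxx.
pose depth v := ex_minn (exP v).
have depth_le v (p : seq (vertex G)) :
    path (adj F) rho p -> last rho p = v -> (depth v <= size p)%N.
  move=> pp pv; rewrite /depth; case: ex_minnP => n _; apply.
  by apply/existsP; exists (in_tuple p); rewrite /= pp pv eqxx.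
have step v : exists ue : option (vertex G * edge G), v != rho -> exists u e,
    [/\ ue = Some (u, e), e \notin F, depth v = (depth u).+1 &
        (src e = u /\ tgt e = v) \/ (tgt e = u /\ src e = v)].
  have [_|vr] := eqVneq v rho; first by exists None.
  have : P v (depth v) by rewrite /depth; case: ex_minnP.
  move=> /existsP[[p /= /eqP sp]] /andP[pp /eqP pv].
  case/lastP: p => [|p w] in sp pp pv; first by rewrite -pv eqxx in vr.
  move: pp; rewrite last_rcons in pv; rewrite rcons_path pv => /andP[pp uv].
  move: (uv) => /existsP[e /andP[eF he]]; exists (Some (last rho p, e)) => _.
  exists (last rho p), e; split=> //=.
    apply/eqP; rewrite eqn_leq -{2}sp size_rcons ltnS depth_le// andbT.
    have : P (last rho p) (depth (last rho p)) by rewrite /depth; case: ex_minnP.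
    move=> /existsP[[s /= /eqP ss]] /andP[ps /eqP lps];
      rewrite -ss -(size_rcons s v).
    by apply: depth_le; rewrite ?last_rcons// rcons_path ps lps.
  by case/orP: he => /andP[/eqP -> /eqP ->]; [left|right].
have [par hpar] := choice step; exists depth, par; split=> //.
by apply/eqP; rewrite -leqn0; exact: (depth_le rho [::]).
Qed.

End Orientation.

Local Open Scope classical_set_scope.
Local Open Scope ring_scope.

(** * Topology of the metric graph *)

Section Topology.
Context {R : realType} {G : graph}.
Local Notation Gam := (mgraph R G).
Implicit Types (e : edge G) (v : vertex G) (x y : Gam) (U V : set Gam).

Definition glue (T : Type) (hv : vertex G -> T) (he : edge G -> R -> T) (x :
  Gam) : T :=
  match x with inl v => hv v | inr (e, u) => he e (val u) end.

Lemma glueE (T : Type) (hv : vertex G -> T) (he : edge G -> R -> T) e t :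
  he e 0 = hv (src e) -> he e 1 = hv (tgt e) -> 0 <= t <= 1 ->
  glue hv he (epoint e t) = he e t.
Proof.
move=> h0 h1; case/unit_itvP => [->|->|ht]; last by rewrite epointE.
- by rewrite epoint0 /= h0.
- by rewrite epoint1 /= h1.
Qed.

(** All lower bounds on distances below come from this, applied to test functions that are
    1-Lipschitz on each closed edge. *)
Lemma lip_mdist (h : Gam -> R) x y :
  (forall e s t, 0 <= s <= 1 -> 0 <= t <= 1 ->
     `|h (epoint e s) - h (epoint e t)| <= `|s - t|) ->
  `|h x - h y| <= mdist x y.
Proof.
move=> hh; apply: path_dist_ge => l.
elim=> [{}x|e s t {}y m hs ht _ IH]; first by rewrite subrr normr0.
by rewrite (le_trans (ler_distD (h (epoint e t)) _ _))// lerD// hh.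
Qed.

Lemma epoint_le0 e t : t <= 0 -> epoint e t = vpoint (src e) :> Gam.
Proof. by move=> t0; rewrite /epoint insubF ?t0// ltNge t0. Qed.

Lemma epoint_ge1 e t : 1 <= t -> epoint e t = vpoint (tgt e) :> Gam.
Proof.
move=> t1; rewrite /epoint insubF ?(lt_geF (lt_le_trans ltr01 t1))//.
by rewrite andbC ltNge t1.
Qed.

(** Valid for all real parameters, since [epoint] clamps to the unit interval and clamping is
    1-Lipschitz. *)
Lemma mdist_epoint e s t : mdist (epoint e s) (epoint e t : Gam) <= `|s - t|.
Proof.
pose c r : R := Num.max 0 (Num.min 1 r).
have cE r : epoint e r = epoint e (c r) :> Gam.
  rewrite /c /Num.max /Num.min; have [r1|r1] := ltP 1 r.
    by rewrite ltr01 epoint_ge1 ?ltW// epoint1.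
  by have [//|r0] := ltP 0 r; rewrite epoint_le0 ?epoint0.
rewrite (cE s) (cE t); apply: le_trans (_ : `|c s - c t| <= _).
  apply: path_dist_le; apply: path_length1; rewrite /c /Num.max /Num.min;
  by do 2?case: ifPn; lra.
have := ler_norm (s - t); have := ler_norm (t - s); rewrite (distrC t).
by rewrite ler_norml /c /Num.max /Num.min; do ?case: ifPn; lra.
Qed.

Lemma epoint_continuous e : continuous (epoint e : R -> Gam).
Proof.
move=> t; apply/metricType_numDomainType.cvgrPdist_lt => eps eps0.
have : \forall s \near t, `|t - s| < eps by exists eps.
by apply: filterS => s; apply: le_lt_trans; exact: mdist_epoint.
Qed.

Lemma star_vertex v y : mdist (vpoint v) y < 1 / 2 -> y = vpoint v \/
  exists e t, [/\ 0 <= t <= 1, y = epoint e t &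
    (src e = v /\ t <= mdist (vpoint v) y) \/
    (tgt e = v /\ 1 - t <= mdist (vpoint v) y)].
Proof.
(* [hv] and [he] together describe the distance to [v] truncated at 1/2. *)
pose hv w : R := (w != v)%:R / 2.
pose he e t : R := Num.min (1 / 2)
   (Num.min ((src e != v)%:R / 2 + t) ((tgt e != v)%:R / 2 + 1 - t)).
have hE e t : 0 <= t <= 1 -> glue hv he (epoint e t) = he e t.
  apply: glueE; rewrite /he /hv; case: (src e == v); case: (tgt e == v) => /=;
  rewrite /Num.min; do ?case: ifPn; lra.
have := @lip_mdist (glue hv he) (vpoint v) y; move=> /(_ _)/wrap[e s t hs ht|].
  rewrite !hE// /he; set a := _ / 2; set b := _ / 2; rewrite ler_norml.
  have := ler_norm (s - t); have := ler_norm (t - s); rewrite (distrC t).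
  set n := `| _ |; rewrite /Num.min; do ?case: ifPn; lra.
set D := mdist _ _; rewrite /= /hv eqxx mul0r sub0r normrN => /ler_normlW hD D2.
case: y => [w|[e u]] /= in D hD D2 *.
  left; have [->//|nw] := eqVneq w v; exfalso; move: hD; rewrite nw /=; lra.
right; exists e, (val u); rewrite epoint_in; have /= hu := valP u; split=> //=.
  by case/andP: hu => /ltW -> /ltW ->.
move: hD; rewrite /he !ge_min => /or3P[h|h|h]; first by exfalso; lra.
- left; move: h; case: (eqVneq (src e) v) => [->|_] /= h; last by exfalso; lra.
  by split=> //; lra.
- right; move: h; case: (eqVneq (tgt e) v) => [->|_] /= h; last by exfalso; lra.
  by split=> //; lra.
Qed.

Lemma star_edge e u y : mdist (inr (e, u) : Gam) y < Num.min (val u) (1 - val u)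
  ->
  exists t, [/\ 0 <= t <= 1, y = epoint e t & `|val u - t| <= mdist (inr (e, u) :
    Gam) y].
Proof.
pose a : R := val u; have ha : 0 < a < 1 by exact: valP u.
rewrite -/a; set r := Num.min _ _.
have [r_a r_1a r0] : [/\ r <= a, r <= 1 - a & 0 < r].
  by rewrite /r /Num.min; case: ifPn => *; split; lra.
(* Here the test function is the distance to the given point truncated at [r]. *)
pose hv (_ : vertex G) : R := r.
pose he e' t : R := if e' == e then Num.min r `|a - t| else r.
have hE e' t : 0 <= t <= 1 -> glue hv he (epoint e' t) = he e' t.
  apply: glueE; rewrite /he /hv; case: eqP => // _; apply: min_l.
    by rewrite subr0 gtr0_norm; lra.
  by rewrite ltr0_norm; lra.
have := @lip_mdist (glue hv he) (inr (e, u)) y; move=> /(_ _)/wrap[e' s t hs ht|].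
  rewrite !hE// /he; case: eqP => _; last by rewrite subrr normr0.
  have := ler_distD t s a; have := ler_distD s t a.
  rewrite (distrC t s) !(distrC a); set b := `|s - a|; set c := `|t - a|.
  by set n := `|s - t| => h1 h2; rewrite ler_norml /Num.min; do ?case: ifPn; lra.
set D := mdist _ _; rewrite /= -/a /he eqxx subrr normr0.
have -> : Num.min r 0 = 0 by apply: min_r; lra.
rewrite sub0r normrN => /ler_normlW hD D2.
case: y => [w|[e' u']] /= in D hD D2 *; first by rewrite /hv in hD; exfalso; lra.
move: hD; case: eqVneq => [->|_] hD; last by exfalso; lra.
exists (val u'); rewrite epoint_in; have /andP[u'0 u'1] := valP u'; split=> //=.
  by rewrite !ltW.
by move: hD; rewrite ge_min => /orP[|//] hD; exfalso; lra.
Qed.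

Lemma local_star x : exists2 r, 0 < r & forall y, mdist x y < r -> y = x \/
  exists e s t, [/\ 0 <= s <= 1, 0 <= t <= 1, x = epoint e s, y = epoint e t
                  & `|s - t| <= mdist x y].
Proof.
case: x => [v|[e u]].
  exists (1 / 2) => [|y /star_vertex[|[e [t [ht -> [[sv tD]|[tv tD]]]]]]];
    first lra.
  - by left.
  - right; exists e, 0, t; rewrite epoint0 sv lexx ler01; split=> //.
    by rewrite sub0r normrN ger0_norm//; case/andP: ht.
  - right; exists e, 1, t; rewrite epoint1 tv lexx ler01; split=> //.
    by rewrite ger0_norm// subr_ge0; case/andP: ht.
have hu := valP u; rewrite /= in hu.
exists (Num.min (val u) (1 - val u)) => [|y /star_edge[t [ht -> tD]]].
  by rewrite /Num.min /=; case: ifPn; lra.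
right; exists e, (val u), t; rewrite epoint_in; split=> //.
by case/andP: hu => /ltW -> /ltW ->.
Qed.

Lemma epoint_param e s x : 0 <= s <= 1 -> epoint e s = x ->
  [\/ s = 0, s = 1 | exists2 u, x = inr (e, u) & s = val u].
Proof.
case/unit_itvP => [->|->|hs]; [by constructor 1|by constructor 2|].
by rewrite epointE => <-; constructor 3; eexists; first reflexivity.
Qed.

Lemma near_mdist x (r : R) (P : Gam -> Prop) : 0 < r ->
  (forall y, mdist x y < r -> P y) -> \forall y \near x, P y.
Proof.
by move=> r0 hP; apply/nbhs_ballP; exists r => //= y; rewrite ballEmdist; exact:
  hP.
Qed.

(* The metric topology is the weak topology of the cell complex. *)
Lemma nbhs_mgraphP x U : nbhs x U <-> U x /\
  forall e s, 0 <= s <= 1 -> epoint e s = x ->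
    \forall t \near s, 0 <= t <= 1 -> U (epoint e t).
Proof.
split=> [Ux|[Ux hU]].
  split; first exact: nbhs_singleton.
  move=> e s hs esx; have := @epoint_continuous e s;
    rewrite /continuous_at esx => /(_ _ Ux) Us.
  have {}Us : \forall t \near s, U (epoint e t) by [].
  by apply: filterS Us => t Ut _.
pose good (e : edge G) s y := 0 <= s <= 1 -> epoint e s = x -> forall t,
  0 <= t <= 1 -> y = epoint e t -> `|s - t| <= mdist x y -> U y.
have goodP e s : \forall y \near x, good e s y.
  have [[hs esx]|nh] := EM ((0 <= s <= 1) /\ epoint e s = x); last first.
    by near=> y => hs esx; case: nh.
  have [d /= d0 hd] := hU e s hs esx.
  apply: (near_mdist d0) => y xy _ _ t ht yt st.
  by rewrite yt; apply: hd => //=; exact: le_lt_trans xy.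
(* A parameter of [x] on any edge is 0, 1 or [u0], so finitely many conditions per edge suffice. *)
pose u0 : R := if x is inr (_, u) then val u else 0.
have : \forall y \near x, forall e, [/\ good e 0 y, good e 1 y & good e u0 y].
  apply: (@filter_forall Gam (edge G)
    (fun e => [set y | [/\ good e 0 y, good e 1 y &
      good e u0 y]]) (nbhs x) (nbhs_filter x)) => e; near=> y; split; near: y;
      exact: goodP.
have [r r0 hr] := local_star x.
have : \forall y \near x, mdist x y < r.
  exact: (near_mdist r0 (fun y h => h)).
apply: filterS2 => y /hr[->//|[e [s [t [hs ht xs yt st]]]]] /(_ e)[g0 g1 gu].
case: (epoint_param hs (esym xs)) => [s0|s1|[u xu su]].
- by rewrite s0 in hs xs st; exact: (g0 hs (esym xs) t ht yt st).
- by rewrite s1 in hs xs st; exact: (g1 hs (esym xs) t ht yt st).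
- have u0s : s = u0 by rewrite /u0 xu.
  by rewrite u0s in hs xs st; exact: (gu hs (esym xs) t ht yt st).
Unshelve. all: by end_near. Qed.

End Topology.

Lemma connected_split (T : topologicalType) (A U V : set T) : connected A ->
  open U -> open V -> A `<=` U `|` V -> A `&` U `&` V = set0 -> A `&` U !=set0 ->
    A `<=` U.
Proof.
move=> cA oU oV AUV AUV0 AU; have := cA _ AU; move=> /(_ _ _)/wrap[| |<- x []//].
- by exists U.
- exists (~` V); first exact: open_closedC.
  apply/seteqP; split=> x [Ax Ux]; split=> //; last by case: (AUV _ Ax).
  by move=> Vx; have : (A `&` U `&` V) x by []; rewrite AUV0.
Qed.

(** * Valency of the points of the metric graph *)

Section Valency.
Context {R : realType} {G : graph}.
Local Notation Gam := (mgraph R G).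
Implicit Types (e : edge G) (v : vertex G) (x y : Gam) (U V : set Gam).

Lemma open_mgraphP U : open U <-> forall e s, 0 <= s <= 1 -> U (epoint e s) ->
  \forall t \near s, 0 <= t <= 1 -> U (epoint e t).
Proof.
split=> [oU e s hs Us|hU].
  have /nbhs_mgraphP[_ ] : nbhs (epoint e s : Gam) U by exact: open_nbhs_nbhs.
  exact.
rewrite openE => x Ux; apply/nbhs_mgraphP; split=> // e s hs esx.
by apply: hU => //; rewrite esx.
Qed.

Lemma continuous_mgraph (T : topologicalType) (f : Gam -> T) (g : edge G -> R ->
  T) :
  (forall e, continuous (g e)) -> (forall e t, 0 <= t <= 1 ->
    f (epoint e t) = g e t) ->
  continuous f.
Proof.
move=> gc fg x U Ux; apply/nbhs_mgraphP; split; first exact: nbhs_singleton Ux.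
move=> e s hs esx; rewrite -esx fg// in Ux.
have Us : \forall t \near s, U (g e t) := gc e s U Ux.
by apply: filterS Us => t Ut ht; rewrite /= fg.
Qed.

Lemma connected_epoint e (A : set R) : connected A -> connected (epoint e @` A :
  set Gam).
Proof.
move=> cA; apply: connected_continuous_connected => //.
exact/continuous_subspaceT/epoint_continuous.
Qed.

Lemma epoint_inj e e' s t : 0 < s < 1 -> epoint e s = epoint e' t :> Gam ->
  e = e' /\ s = t.
Proof.
move=> hs; rewrite epointE /epoint; case: insubP => [u hu ut|_]; last by case:
  ifP.
by move=> [-> su]; rewrite -ut -su.
Qed.

Lemma mdist_inner e s t : 0 < s < 1 -> `|s - t| < Num.min s (1 - s) ->
  mdist (epoint e s) (epoint e t : Gam) = `|s - t|.
Proof.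
move=> hs st; apply/eqP; rewrite eq_le mdist_epoint/=.
have := @star_edge R G e (Sub s hs) (epoint e t); rewrite SubK -epoint_in SubK.
move=> /(_ (le_lt_trans (mdist_epoint _ _ _) st))[t' [ht' tt' le]].
have ht : 0 < t < 1.
  have := ler_norm (s - t); have := ler_norm (t - s); rewrite (distrC t).
  move: st; rewrite lt_min => /andP[]; lra.
by move: le; have [_ <-] := epoint_inj ht tt'.
Qed.

(** Count the sphere of small radius [s]: it has one point on each of the [n] rays, and it consists
    of the two points of the edge at parameters [a + s] and [a - s]. The radius is below that of the
    star, that of the ball it covers, and the distances to both ends. *)
Lemma inner_valency e u n : has_valency (inr (e, u) : Gam) n -> n = 2%N.
Proof.
pose a : R := val u; have ha : 0 < a < 1 by exact: valP u.
have -> : inr (e, u) = epoint e a :> Gam by rewrite epoint_in.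
move=> [r [f [r0 f0 fd /nbhs_ballP[d /= d0 hd]]]].
pose s := Num.min (Num.min r d) (Num.min a (1 - a)) / 2.
have [s0 s_r s_d s_a s_1a] : [/\ 0 < s, s < r, s < d, s < a & s < 1 - a].
  have : 0 < Num.min (Num.min r d) (Num.min a (1 - a)).
    by rewrite !lt_min r0 d0; lra.
  rewrite /s; set m := Num.min _ _ => m0.
  have [/ltW + /ltW +] : m / 2 < m /\ 0 < m by split=> //; lra.
  have : m <= m by []; rewrite {2}/m !le_min => /andP[/andP[? ?] /andP[? ?]] _ _.
  by split; lra.
pose c (b : bool) := if b then a + s else a - s.
have dc b : mdist (epoint e a) (epoint e (c b) : Gam) = s.
  have cs : `|a - c b| = s.
    by case: b; rewrite /c; [rewrite ltr0_norm|rewrite gtr0_norm]; lra.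
  by rewrite mdist_inner// cs// lt_min s_a.
have fc k : exists b, f k s = epoint e (c b).
  have ds : mdist (epoint e a) (f k s) = s.
    by rewrite -(f0 k) fd ?lexx ?r0 ?s_r ?ltW// eqxx sub0r normrN gtr0_norm.
  have := @star_edge R G e u (f k s); rewrite -epoint_in -/a ds lt_min s_a s_1a.
  move=> /(_ isT)[t [ht ft ts]].
  have st : s <= `|a - t| by rewrite -{1}ds ft mdist_epoint.
  have : `|a - t| = s by apply/le_anti; rewrite ts st.
  have [at0|at0] := ger0P (a - t) => ats.
    by exists false; rewrite ft /c; congr epoint; lra.
  by exists true; rewrite ft /c; congr epoint; lra.
have cf b : exists k, f k s = epoint e (c b).
  have : (epoint e a |` \bigcup_k (f k @` `[0, r[)) (epoint e (c b) : Gam).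
    by apply: hd; rewrite ballEmdist /= dc.
  move=> [cb|[k _ [t /=]]]; first by have := dc b; rewrite cb mdistxx; lra.
  rewrite in_itv/= => /andP[t0 tr] ft; exists k.
  have := dc b; rewrite -ft -(f0 k) fd ?lexx ?r0 ?t0 ?tr// eqxx sub0r normrN
    ger0_norm//.
  by move=> <-.
have [phi hphi] := choice fc; have [psi hpsi] := choice cf.
have phi_inj : injective phi.
  move=> k l kl; apply/eqP; apply: contraT => /negPf nkl.
  have := fd k l s s; rewrite nkl hphi hphi kl mdistxx s_r ltW//= => /(_ isT isT).
  lra.
have c_inj b b' : epoint e (c b) = epoint e (c b') :> Gam -> b = b'.
  move=> /epoint_inj[|_]; first by case: b; rewrite /c; lra.
  by case: b; case: b' => //; rewrite /c => ?; exfalso; lra.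
have psi_inj : injective psi.
  by move=> b b' bb'; apply: c_inj; rewrite -!hpsi bb'.
have := leq_card _ phi_inj; have := leq_card _ psi_inj.
by rewrite card_bool card_ord; lia.
Qed.

(** Half-edges at [v], the flag [true] marking the source end, so that a loop counts twice. *)
Definition darts v : seq (edge G * bool) :=
  [seq (e, true) | e <- enum (edge G) & src e == v] ++
  [seq (e, false) | e <- enum (edge G) & tgt e == v].

Definition dart_ray (eb : edge G * bool) (h : R) : Gam :=
  epoint eb.1 (if eb.2 then h else 1 - h).

Lemma mem_darts v eb : (eb \in darts v) = ((if eb.2 then src eb.1 else tgt eb.1)
  == v).
Proof.
case: eb => e b; rewrite mem_cat; apply/orP/idP => /=.
  by case=> /mapP[e' + [-> ->]]; rewrite mem_filter => /andP[].
by case: b => he; [left|right]; apply/mapP; exists e;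
  rewrite // mem_filter he mem_enum.
Qed.

Lemma darts_uniq v : uniq (darts v).
Proof.
have inj (b : bool) : injective (fun e : edge G => (e, b)) by move=> ? ? [].
rewrite cat_uniq; apply/and3P; split.
- by rewrite (map_inj_uniq (inj true)); apply/filter_uniq/enum_uniq.
- by apply/hasPn => _ /mapP[e _ ->]; apply/mapP => -[].
- by rewrite (map_inj_uniq (inj false)); apply/filter_uniq/enum_uniq.
Qed.

Lemma size_darts v : size (darts v) = (#|[set e | src e == v]%SET| + #|[set e |
  tgt e == v]%SET|)%N.
Proof.
rewrite size_cat !size_map !size_filter -!sum1_count !big_enum_cond -!sum1_card.
by congr addn; apply: eq_bigl => e; rewrite finset.inE.
Qed.

Lemma dart_ray0 v eb : eb \in darts v -> dart_ray eb 0 = vpoint v.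
Proof.
case: eb => e b; rewrite mem_darts /dart_ray /=; case: b => /eqP <-.
  by rewrite epoint0.
by rewrite subr0 epoint1.
Qed.

(** Equal to [s] up to 1/4 and zero beyond 1/2, so that the tents at the two ends of an edge do not
    overlap. *)
Let tent (s : R) : R := Num.max 0 (Num.min s (1 / 2 - s)).

Let bump (eb : edge G * bool) : Gam -> R := glue (fun _ => 0)
  (fun e t => if e == eb.1 then tent (if eb.2 then t else 1 - t) else 0).

Let bumpE eb e t : 0 <= t <= 1 -> bump eb (epoint e t) =
  if e == eb.1 then tent (if eb.2 then t else 1 - t) else 0.
Proof.
apply: glueE; case: eqP => // _; case: eb.2;
by rewrite /tent /Num.max /Num.min; do ?case: ifPn; lra.
Qed.

Let tent_lip (s t : R) : `|tent s - tent t| <= `|s - t|.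
Proof.
have := ler_norm (s - t); have := ler_norm (t - s); rewrite (distrC t).
by rewrite ler_norml /tent /Num.max /Num.min; do ?case: ifPn; lra.
Qed.

Let tent2_lip (s t : R) : 0 <= s <= 1 -> 0 <= t <= 1 ->
  `|tent s - tent (1 - s) - (tent t - tent (1 - t))| <= `|s - t|.
Proof.
move=> hs ht; have := ler_norm (s - t); have := ler_norm (t - s);
  rewrite (distrC t).
rewrite ler_norml /tent /Num.max /Num.min; do ?case: ifPn; lra.
Qed.

(** The upper bound follows the ray or passes through [v]. The lower bound tests with one bump for
    equal darts and with the difference of two bumps for distinct ones; when these lie on the same
    loop, the difference is still 1-Lipschitz because the tents do not overlap. *)
Lemma mdist_dart_ray v eb eb' s t : eb \in darts v -> eb' \in darts v ->
  0 <= s < 1 / 4 -> 0 <= t < 1 / 4 ->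
  mdist (dart_ray eb s) (dart_ray eb' t) = if eb == eb' then `|s - t| else s + t.
Proof.
move=> hb hb' hs ht; have subN (a b : R) : 1 - a - (1 - b) = b - a by ring.
apply/le_anti/andP; split.
  case: eqP => [->|_].
    apply: (le_trans (mdist_epoint _ _ _)); case: eb'.2 => //.
    by rewrite subN distrC.
  apply: le_trans (metric_triangle _ (vpoint v) _) _.
  rewrite -{1}(dart_ray0 hb) -(dart_ray0 hb'); apply: lerD.
    apply: (le_trans (mdist_epoint _ _ _)); case: eb.2.
      by rewrite subr0 ger0_norm; lra.
    by rewrite subr0 ler0_norm; lra.
  apply: (le_trans (mdist_epoint _ _ _)); case: eb'.2.
    by rewrite sub0r normrN ger0_norm; lra.
  by rewrite subr0 ger0_norm; lra.
have bE (x : edge G * bool) (w : R) : 0 <= w < 1 / 4 -> bump x (dart_ray x w) = w.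
  move=> hw; rewrite /dart_ray bumpE ?eqxx; last by case: x.2; lra.
  case: x.2; rewrite /tent /Num.max /Num.min; do ?case: ifPn; lra.
have bE' (x x' : edge G * bool) (w : R) : 0 <= w < 1 / 4 -> x != x' ->
  bump x (dart_ray x' w) = 0.
  move=> hw xx'; rewrite /dart_ray bumpE; last by case: x'.2; lra.
  move: x x' xx' => [e b] [e' b']; rewrite xpair_eqE /=.
  case: (eqVneq e' e) => [_|//] /= bb'.
  have -> : b = ~~ b' by case: b b' bb' => -[].
  by case: b' {bb'}; rewrite /tent /Num.max /Num.min /=; do ?case: ifPn; lra.
have lip (x : edge G * bool) e (w z : R) : 0 <= w <= 1 -> 0 <= z <= 1 ->
     `|bump x (epoint e w) - bump x (epoint e z)| <= `|w - z|.
  move=> hw hz; rewrite !bumpE//; case: eqP => _; last by rewrite subrr normr0.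
  case: x.2; first exact: tent_lip.
  by apply: (le_trans (tent_lip _ _)); rewrite subN distrC.
case: eqP => [<-|/eqP bb'].
  by rewrite -{1}(bE eb s)// -{1}(bE eb t)//; apply: lip_mdist; exact: lip.
have := @lip_mdist R G (fun x => bump eb x - bump eb' x) (dart_ray eb s)
  (dart_ray eb' t).
rewrite !bE// !bE'//; last by rewrite eq_sym.
rewrite subr0 sub0r opprK ger0_norm; last by lra.
apply=> e w z hw hz.
have [be|be] := eqVneq e eb.1; last first.
  have zero r : 0 <= r <= 1 -> bump eb (epoint e r) = 0.
    by move=> hr; rewrite bumpE// (negPf be).
  by rewrite !zero// !sub0r -opprD normrN; exact: lip.
have [be'|be'] := eqVneq e eb'.1; last first.
  have zero r : 0 <= r <= 1 -> bump eb' (epoint e r) = 0.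
    by move=> hr; rewrite bumpE// (negPf be').
  by rewrite !zero// !subr0; exact: lip.
have bN : eb'.2 = ~~ eb.2.
  move: bb'; rewrite -pair_eqE /pair_eq /= -be -be' eqxx /=.
  by case: eb.2; case: eb'.2.
rewrite !bumpE// -be -be' eqxx bN; case: eb.2 => /=; first exact: tent2_lip.
have := @tent2_lip (1 - w) (1 - z); rewrite !subKr subN (distrC z).
by apply; lra.
Qed.

Lemma vertex_valency v : has_valency (vpoint v : Gam) (size (darts v)).
Proof.
pose f (k : 'I_(size (darts v))) := dart_ray (tnth (in_tuple (darts v)) k).
have mem k : tnth (in_tuple (darts v)) k \in darts v by exact: mem_tnth.
exists (1 / 4), f; split=> [|k|k l s t hs ht|]; first by lra.
- exact: dart_ray0.
- rewrite (mdist_dart_ray (mem k) (mem l))//.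
  by have /inj_eq -> : injective (tnth (in_tuple (darts v))) by
    apply/tuple_uniqP/darts_uniq.
have r0 : (0 : R) < 1 / 4 by lra.
apply: (near_mdist r0) => y vy; have [|->|[e [t [ht yt he]]]] :=
  @star_vertex R G v y.
- by apply: lt_trans vy _; lra.
- by left.
right; suff [b [hb hbt]] : exists b, (e, b) \in darts v /\ exists2 s : R,
  y = dart_ray (e, b) s & 0 <= s < 1 / 4.
  have [s ys hs] := hbt; move: hb => /(nthP (e, b))[i i_lt ei].
  exists (Ordinal i_lt) => //; exists s; first by rewrite /= in_itv.
  by rewrite /f (tnth_nth (e, b)) /= ei.
case: he => -[ve le]; [exists true|exists false]; rewrite mem_darts /= ve eqxx;
  split=> //.
- by exists t; last lra.
- by exists (1 - t); last lra; rewrite yt /dart_ray /= subKr.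
Qed.

Lemma nonbranch_degree v : ~ branch_points Gam (vpoint v) -> size (darts v) = 2%N.
Proof.
move=> nb; apply: contrapT => n2; apply: nb; exists (size (darts v)) => //.
exact: vertex_valency.
Qed.

Lemma inner_nonbranch e u : ~ branch_points Gam (inr (e, u)).
Proof. by move=> [n n2 /inner_valency]. Qed.

Definition edge_interior e : set Gam := [set x | exists u, x = inr (e, u)].

Lemma edge_interiorE e : edge_interior e = epoint e @` `]0, 1[.
Proof.
apply/seteqP; split=> [x [u ->]|x [t /=]].
  by exists (val u); rewrite ?epoint_in//= in_itv /=; exact: valP u.
by rewrite in_itv /= => ht <-; rewrite epointE; eexists.
Qed.

Lemma open_inner_itv e (a b : R) : 0 <= a -> b <= 1 -> open (epoint e @` `]a,
  b[ : set Gam).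
Proof.
move=> a0 b1; apply/open_mgraphP => e' s hs [t /=]; rewrite in_itv /= =>
  /andP[a_t tb] ts.
have [|<- st] := epoint_inj _ ts; first by lra.
have : \forall r \near t, r \in `]a, b[ by apply: near_in_itv;
  rewrite in_itv /= a_t.
by rewrite -st; apply: filterS => r hr _; exists r.
Qed.

Lemma edge_interior_segment e : open_edge_segment (edge_interior e).
Proof.
have h0 : 0 < (1 / 2 : R) < 1 by lra.
have mid : edge_interior e (epoint e (1 / 2)) by rewrite epointE; eexists.
have conn : connected (edge_interior e).
  by rewrite edge_interiorE; apply: connected_epoint;
    apply/connected_intervalP/interval_is_interval.
split=> //; first by exists (epoint e (1 / 2)).
- by rewrite edge_interiorE; exact: open_inner_itv.
- exists (connected_component (~` branch_points Gam) (epoint e (1 / 2))).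
    exists (epoint e (1 / 2)) => //; rewrite epointE; exact: inner_nonbranch.
  apply: connected_component_max => // x [u ->]; exact: inner_nonbranch.
Qed.

Lemma closure_edge_interior e v : src e = v \/ tgt e = v ->
  closure (edge_interior e) (vpoint v).
Proof.
move=> hv U /nbhs_mgraphP[_ hU].
have [s hs [sv s01]] : exists2 s : R, 0 <= s <= 1 &
  epoint e s = vpoint v :> Gam /\ (s = 0 \/ s = 1).
  by case: hv => <-; [exists 0; rewrite ?epoint0|exists 1; rewrite ?epoint1];
    rewrite ?lexx ?ler01//;
  split=> //; [left|right].
have [d /= d0 hd] := hU e s hs sv.
pose m := Num.min d 1 / 2.
have [m0 md m1] : [/\ 0 < m, m < d & m < 1].
  have : 0 < Num.min d 1 by rewrite lt_min d0 ltr01.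
  have : Num.min d 1 <= d by rewrite ge_min lexx.
  have : Num.min d 1 <= 1 by rewrite ge_min lexx orbT.
  by rewrite /m; split; lra.
pose t := if s == 0 then m else 1 - m.
have ht : 0 < t < 1 by rewrite /t; case: ifP; lra.
exists (epoint e t); split; first by rewrite epointE; eexists.
apply: hd; last by lra.
rewrite /= /t; case: s01 => ->; first by rewrite eqxx sub0r normrN gtr0_norm.
by rewrite oner_eq0 subKr gtr0_norm.
Qed.

Lemma edge_interior_closure_meets e x (A : set Gam) : edge_interior e x ->
  closure A x ->
  exists u, A (inr (e, u)).
Proof.
move=> ex /(_ (edge_interior e)) []; last by move=> y [Ay [u yu]]; exists u;
  rewrite -yu.
have [_ + _ _] := edge_interior_segment e; rewrite openE => /(_ _ ex); exact.
Qed.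

End Valency.

(** * Puncturing a metric graph along a break divisor *)

Section Puncture.
Context {R : realType} {G : graph}.
Local Notation Gam := (mgraph R G).
Implicit Types (e : edge G) (v : vertex G) (x y : Gam) (U V : set Gam).

Lemma segment_side U V e (a b s t : R) : open U -> open V -> U `&` V = set0 ->
  (forall r, a <= r <= b -> (U `|` V) (epoint e r)) ->
  a <= s <= b -> a <= t <= b -> U (epoint e s) -> U (epoint e t).
Proof.
move=> oU oV UV cov hs ht Us.
have := @connected_split _ (epoint e @` `[a, b] : set Gam) U V.
move=> /(_ (connected_epoint (@segment_connected R a b)) oU oV)/(_ _ _ _ (epoint
  e t)).
apply.
- by move=> _ [r /= hr <-]; apply: cov; rewrite in_itv in hr.
- by rewrite -setIA UV setI0.
- by exists (epoint e s); split=> //; exists s; rewrite //= in_itv.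
- by exists t; rewrite //= in_itv.
Qed.

Lemma vertex_set_full (B : set (vertex G)) v0 : B v0 ->
  (forall e, B (src e) <-> B (tgt e)) -> forall v, B v.
Proof.
move=> Bv0 he v; have /connectP[p] := adj0 v0 v.
elim: p v0 Bv0 => [v0 ? _ ->//|w p IH v0 Bv0] /= /andP[/existsP[e /andP[_ hvw]]
  /IH{}IH].
apply: IH; move: hvw => /orP[]/andP[/eqP ev /eqP ew]; first by rewrite -ew -he ev.
by rewrite -ev he ew.
Qed.

Lemma mgraph_connected U V x : open U -> open V -> U `&` V = set0 ->
  (forall y, (U `|` V) y) -> U x -> forall y, U y.
Proof.
move=> oU oV UV cov Ux.
have side e s t : 0 <= s <= 1 -> 0 <= t <= 1 -> U (epoint e s) -> U (epoint e t).
  exact: segment_side UV _.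
have i0 : 0 <= (0 : R) <= 1 by rewrite lexx ler01.
have i1 : 0 <= (1 : R) <= 1 by rewrite lexx ler01.
have u01 (u : {t : R | 0 < t < 1}) : 0 <= val u <= 1.
  by have /andP[/ltW-> /ltW->] := valP u.
have [v0 Uv0] : exists v, U (vpoint v).
  case: x Ux => [v Uv|[e u]]; first by exists v.
  by rewrite -epoint_in => /(side _ _ 0) Us; exists (src e); rewrite -epoint0;
    exact: Us.
have Uv : forall v, U (vpoint v).
  apply: (@vertex_set_full (fun v => U (vpoint v)) v0) => // e.
  by rewrite -epoint0 -epoint1; split; exact: side.
case=> [v|[e u]]; first exact: Uv.
by rewrite -epoint_in; apply: (side _ 0) => //; rewrite epoint0; exact: Uv.
Qed.

(* The two sides of q cannot be told apart unless U contains exactly one of the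
   two half-edges at q; in that case the handshake lemma in U fails. *)
Lemma one_puncture U V e0 (t0 : R) : 0 < t0 < 1 -> open U -> open V ->
  U `&` V = set0 ->
  (forall y, y <> epoint e0 t0 -> (U `|` V) y) ->
  ~ U (epoint e0 t0) -> ~ V (epoint e0 t0) ->
  (forall v, U (vpoint v) -> size (darts v) = 2%N) -> V !=set0 -> U = set0.
Proof.
move=> ht0 oU oV UV cov nUq nVq deg2 [y0 Vy0].
have VU : V `&` U = set0 by rewrite setIC.
have cov' y : y <> epoint e0 t0 -> (V `|` U) y by rewrite setUC; exact: cov.
have side A B e s t : open A -> open B -> A `&` B = set0 ->
    (forall y, y <> epoint e0 t0 -> (A `|` B) y) ->
    [\/ e != e0, s < t0 /\ t < t0 | t0 < s /\ t0 < t] ->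
    0 <= s <= 1 -> 0 <= t <= 1 -> A (epoint e s) -> A (epoint e t).
  move=> oA oB AB covA hst hs ht.
  apply: (segment_side oA oB AB (a := Num.min s t) (b := Num.max s t));
    last first.
  - by rewrite ge_min le_max lexx !orbT.
  - by rewrite ge_min le_max lexx.
  move=> r; rewrite ge_min le_max => hr; apply: covA =>
    /esym /(epoint_inj ht0)[ee rt].
  by case: hst hr; rewrite -?rt ?ee ?eqxx// => -[? ?] /andP[/orP[]? /orP[]?]; lra.
have i0 : 0 <= (0 : R) <= 1 by rewrite lexx ler01.
have i1 : 0 <= (1 : R) <= 1 by rewrite lexx ler01.
have u01 (u : {t : R | 0 < t < 1}) : 0 <= val u <= 1.
  by have /andP[/ltW-> /ltW->] := valP u.
(* If [A] contains all vertices, it contains everything but the puncture, which [B] avoids too. *)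
have full A B : open A -> open B -> A `&` B = set0 ->
    (forall y, y <> epoint e0 t0 -> (A `|` B) y) -> ~ B (epoint e0 t0) ->
    (forall v, A (vpoint v)) -> forall y, ~ B y.
  move=> oA oB AB covA nBq Av y By.
  suff Ay : A y by have : (A `&` B) y by []; rewrite AB.
  case: y By => [v|[e u]] By; first exact: Av.
  have [ee|ne] := eqVneq e e0; last first.
    by rewrite -epoint_in; apply: (side A B e 0) => //;
      [constructor 1|rewrite epoint0; exact: Av].
  have [ut|tu|ut] := ltgtP (val u) t0.
  - rewrite -epoint_in; apply: (side A B e 0) => //; last by rewrite epoint0;
    exact: Av.
    by constructor 2; split=> //; case/andP: ht0.
  - rewrite -epoint_in; apply: (side A B e 1) => //; last by rewrite epoint1;
    exact: Av.
    by constructor 3; split=> //; case/andP: ht0.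
  - by case: nBq; rewrite -ee -ut epoint_in.
have he e : e != e0 -> U (vpoint (src e)) <-> U (vpoint (tgt e)).
  by move=> ne; rewrite -epoint0 -epoint1; split; apply: (side U V) => //;
    constructor 1.
have vcov v : U (vpoint v) \/ V (vpoint v).
  by apply: cov; rewrite (epointE _ ht0).
apply/seteqP; split=> // x Ux.
pose B v := `[< U (vpoint v) >].
have {}he e : e != e0 -> B (src e) = B (tgt e) by move=> /he ne; exact:
  asbool_equiv_eq.
(* Handshake: vertices of [U] have degree 2, so the number of edge ends in [B] is even. Each edge
   other than [e0] contributes 0 or 2, hence so does [e0]. *)
have Be0 : B (src e0) = B (tgt e0).
  have : (\sum_v B v * 2 = \sum_e (B (src e) + B (tgt e)))%N.
    rewrite big_split/= -(@sum_fiber nat _ _ (@src G) (fun _ v => B v : nat)).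
    rewrite -(@sum_fiber nat _ _ (@tgt G) (fun _ v => B v : nat)) -big_split/=.
    apply: eq_bigr => v _; rewrite !sum_nat_const -mulnDl mulnC.
    rewrite /B; case: asboolP => [/deg2 <-|]; last by rewrite !muln0.
    by rewrite size_darts !cardsE.
  rewrite (bigD1 e0)//= (eq_bigr (fun e => B (src e) * 2)%N); last first.
    by move=> e /he ->; rewrite muln2 addnn.
  rewrite -!big_distrl/= => /(congr1 odd); rewrite !oddD !oddM !andbF addbF !oddb.
  by case: (B (src e0)); case: (B (tgt e0)).
have {}he e : B (src e) = B (tgt e) by have [->|/he] := eqVneq e e0.
have [Us|nUs] := boolP (B (src e0)).
  apply: (full U V) Vy0 => // v; apply/asboolP; apply:
    (@vertex_set_full B) Us _ _ => e.
  by rewrite he.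
apply: (full V U) Ux => // v.
have [Uv|//] := vcov v; exfalso; move/negP: nUs; apply.
apply: (@vertex_set_full B v) => [|e]; [exact/asboolP|by rewrite he].
Qed.

End Puncture.

(** * Segments of a break divisor *)

Section BreakSegments.
Context {R : realType} {G : graph}.
Local Notation Gam := (mgraph R G).
Implicit Types (e : edge G) (v : vertex G) (x y : Gam) (U V Q : set Gam).

(** [A] is the union of the tracks of its points under the contraction, all of which end at [c]. *)
Lemma contractible_connected (A : set Gam) : contractible A -> connected A.
Proof.
move=> [H [c [Ac cH HA H0 H1]]].
pose P x : set Gam := (fun t : R => H (t, x)) @` `[0, 1].
have -> : A = \bigcup_(x in A) P x.
  apply/seteqP; split=> [x Ax|_ [x Ax [t /= ht <-]]].
    by exists x => //; exists 0; rewrite ?H0//= in_itv /= lexx ler01.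
  by apply: HA => //; rewrite in_itv in ht.
apply: bigcup_connected.
  by exists c => x Ax; exists 1; rewrite ?H1//= in_itv /= ler01 lexx.
move=> x Ax; apply: connected_continuous_connected (@segment_connected R 0 1) _.
apply/subspace_continuousP => t ht U HU.
have := (@subspace_continuousP _ _ _ H).1 cH (t, x) (conj ht Ax) U HU.
rewrite /= !nbhs_simpl /within /= => -[[S1 S2] /= [S1t S2x] S12].
apply: filterS S1t => s S1s hs; apply: (S12 (s, x)) => //=.
by split=> //; exact: nbhs_singleton.
Qed.

Section Break.
Variables (g : nat) (ee : 'I_g -> set Gam).
Hypothesis ee_seg : forall i, open_edge_segment (ee i).
Hypothesis ee_triv : trivIset setT ee.
Hypothesis ee_contr : contractible (~` \bigcup_i ee i).

Lemma ee_disj i j x : ee i x -> ee j x -> i = j.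
Proof. by move=> ix jx; apply: (ee_triv I I); exists x. Qed.

Lemma ee_nonbranch i x : ee i x -> ~ branch_points Gam x.
Proof.
move=> ix; have [_ _ _ [B [p _ ->] sub]] := ee_seg i.
by have /connected_component_sub := sub _ ix.
Qed.

Lemma complement_split U V : open U -> open V -> U `&` V = set0 ->
  (~` \bigcup_i ee i) `<=` U `|` V ->
  (~` \bigcup_i ee i) `<=` U \/ (~` \bigcup_i ee i) `<=` V.
Proof.
move=> oU oV UV cov; have con := contractible_connected ee_contr.
have [_ [c [Cc _ _ _ _]]] := ee_contr.
have [Uc|Vc] := cov c Cc; [left|right].
  apply: (connected_split con oU oV cov); last by exists c.
  by rewrite -setIA UV setI0.
apply: (connected_split con oV oU); last by exists c.
  by rewrite setUC.
by rewrite -setIA (setIC V) UV setI0.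
Qed.

(** The connected complement of the segments lies on one side, say in [V], so a point of [U] lies in
    some [ee i]. Cutting [U] down to [ee i] and giving the other segments to [V] leaves at most one
    puncture, and the vertices left in [U] have degree 2. *)
Lemma punctured_connected Q U V :
  (forall x, Q x -> (exists e, edge_interior e x) /\ exists i, ee i x) ->
  (forall i x y, Q x -> Q y -> ee i x -> ee i y -> x = y) ->
  open U -> open V -> U `&` V = set0 -> U `|` V = ~` Q -> U = set0 \/ V = set0.
Proof.
move=> hQ Q1; wlog CV : U V / (~` \bigcup_i ee i) `<=` V.
  move=> wl oU oV UV UVQ; have [|CU|CV] := complement_split oU oV UV.
  - by rewrite UVQ => x Cx /hQ[_ [i ix]]; apply: Cx; exists i.
  - by have [] := wl V U CU oV oU; rewrite 1?setIC 1?setUC//; [right|left].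
  - exact: wl.
move=> oU oV UV UVQ; left; apply/seteqP; split=> // x Ux.
have Unot_Q y : U y -> ~ Q y by move=> Uy; have : (U `|` V) y by [left];
  rewrite UVQ.
have Vnot_Q y : V y -> ~ Q y by move=> Vy; have : (U `|` V) y by [right];
  rewrite UVQ.
have UV0 y : U y -> V y -> False by move=> ? ?; have : (U `&` V) y by [];
  rewrite UV.
have [i _ ix] : (\bigcup_i ee i) x by apply: contrapT => /CV; exact: UV0 Ux.
have [_ [c [Cc _ _ _ _]]] := ee_contr.
pose U' := U `&` ee i; pose V' := V `|` \bigcup_(j in [set j | j <> i]) ee j.
have oU' : open U' by apply: openI => //; have [] := ee_seg i.
have oV' : open V'.
  by apply: openU => //; apply: bigcup_open => j _; have [] := ee_seg j.
have UV' : U' `&` V' = set0.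
  apply/seteqP; split=> // y [[Uy iy] [Vy|[j /= ji jy]]]; first exact: UV0 Uy Vy.
  by apply: ji; exact: ee_disj jy iy.
have U'x : U' x by [].
have V'c : V' c by left; exact: CV.
have cov y : ~ (Q y /\ ee i y) -> (U' `|` V') y.
  move=> nQ; have [[j _ jy]|/CV Vy] := EM ((\bigcup_i ee i) y); last by right;
    left.
  have [ji|ji] := EM (j = i); last by right; right; exists j.
  rewrite ji in jy; have : (U `|` V) y by rewrite UVQ => Qy; apply: nQ.
  by case=> [Uy|Vy]; [left|right; left].
(* Without a puncture on [ee i] this contradicts the connectedness of the graph; with one,
   [one_puncture] applies. *)
have [[q [Qq iq]]|noq] := EM (exists q, Q q /\ ee i q); last first.
  have V'U' y : (U' `|` V') y by apply: cov => qy; apply: noq; exists y.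
  have := mgraph_connected oU' oV' UV' V'U' U'x c => U'c.
  by have : (U' `&` V') c by []; rewrite UV'.
have [[e [u qu]] _] := hQ q Qq.
have eu : epoint e (val u) = q by rewrite epoint_in qu.
suff U'0 : U' = set0 by rewrite U'0 in U'x.
apply: (@one_puncture R G U' V' e (val u) (valP u)) => //.
- by move=> y; rewrite eu => yq; apply: cov => -[Qy iy]; apply: yq; exact:
  Q1 iy iq.
- by rewrite eu => -[/Unot_Q].
- rewrite eu => -[/Vnot_Q//|[j /= ji jq]]; apply: ji; exact: ee_disj jq iq.
- by move=> v [_ /ee_nonbranch/nonbranch_degree].
- by exists c.
Qed.

Variable p : 'I_g -> Gam.
Hypothesis p_closure : forall i, closure (ee i) (p i).

Lemma closed_segment e (a b : R) : closed (epoint e @` `[a, b] : set Gam).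
Proof.
apply: compact_closed; first exact: metric_hausdorff.
apply: continuous_compact; last exact: segment_compact.
exact/continuous_subspaceT/epoint_continuous.
Qed.

(** Two such indices would allow punctures at a point of [ee i] and a point of [ee j] inside [e],
    and these cut off the open interval between them. *)
Lemma interior_index_inj e i j :
  edge_interior e (p i) -> edge_interior e (p j) -> i = j.
Proof.
move=> hpi hpj; apply: contrapT => nij.
(* [p i] is only in the closure of [ee i]; the puncture must be a point of [ee i] itself. *)
have [u iu] := edge_interior_closure_meets hpi (@p_closure i).
have [w jw] := edge_interior_closure_meets hpj (@p_closure j).
move=> {hpi hpj}; have lt_absurd : forall i j u w, i <> j -> ee i (inr (e, u)) ->
  ee j (inr (e, w)) ->
    val u < val w -> False.
  move=> {iu jw} {}i {}j {}u {}w {}nij iu jw uw.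
  have /= /andP[u0 u1] := valP u; have /= /andP[w0 w1] := valP w;
    rewrite /= in uw.
  pose Q : set Gam := [set inr (e, u); inr (e, w)].
  have [||||||U0|V0] := @punctured_connected Q (epoint e @` `]val u, val w[)
    (~` (epoint e @` `[val u, val w])).
  - by move=> x [->|->]; (split; [by exists e; eexists|]); [exists i|exists j].
  - move=> k x y [->|->] [->|->] // kx ky; exfalso; apply: nij.
      by rewrite -(ee_disj kx iu) (ee_disj ky jw).
    by rewrite -(ee_disj ky iu) (ee_disj kx jw).
  - by apply: open_inner_itv; exact: ltW.
  - exact/closed_openC/closed_segment.
  - apply/seteqP; split=> // x [[t /= ht <-]]; apply; exists t => //=.
    by move: ht; rewrite !in_itv /= => /andP[/ltW -> /ltW ->].
  - apply/seteqP; split=> x.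
      move=> [[t /= ht <-]|nx].
        rewrite in_itv/= in ht; have ht01 : 0 < t < 1 by lra.
        by rewrite (epointE _ ht01) => -[] [] tE; move: ht;
          rewrite -tE /= ltxx ?andbF.
      move=> [] xE; apply: nx; rewrite xE -epoint_in; eexists; try reflexivity;
      by rewrite /= in_itv /= lexx ltW.
    move=> nQ; have [[t /= + xt]|] := EM ((epoint e @` `[val u, val w]) x);
      last by right.
    rewrite in_itv/= => /andP[ut tw]; left; exists t => //=;
      rewrite in_itv/= !lt_neqAle ut tw !andbT.
    apply/andP; split; apply/eqP => tE; apply: nQ; rewrite -xt -?tE ?epoint_in;
      [left|right] => //.
    by rewrite tE epoint_in.
  - have : (epoint e @` `]val u, val w[) (epoint e ((val u + val w) / 2) : Gam).
      by exists ((val u + val w) / 2); rewrite //= in_itv/=; lra.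
    by rewrite U0.
  - have : (~` (epoint e @` `[val u, val w])) (vpoint (src e) : Gam).
      move=> [t /=]; rewrite in_itv/= => ht; have ht01 : 0 < t < 1 by lra.
      by rewrite (epointE _ ht01).
    by rewrite V0.
have [uw|wu|/val_inj uw] := ltgtP (val u) (val w).
- exact: lt_absurd nij iu jw uw.
- by apply: lt_absurd jw iu wu => ji; apply: nij.
- by apply: nij; rewrite uw in iu; exact: ee_disj iu jw.
Qed.

(** Puncture once each edge with some [p i] inside. The punctured graph is connected, so a vertex
    set closed under the unpunctured edges is everything. *)
Lemma punctured_vertices (A : set (vertex G)) v0 : A v0 ->
  (forall e, ~ (exists i, edge_interior e (p i)) -> A (src e) <-> A (tgt e)) ->
  forall v, A v.
Proof.
move=> Av0 hA.
(* [W] specifies the puncture chosen on each edge, [None] standing for an unpunctured edge. *)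
pose W e (o : option R) : Prop := if o is Some t
  then 0 < t < 1 /\ exists i, edge_interior e (p i) /\ ee i (epoint e t)
  else ~ exists i, edge_interior e (p i).
have exW e : exists o, W e o.
  have [[i hpi]|ni] := EM (exists i, edge_interior e (p i)); last by exists None.
  have [u iu] := edge_interior_closure_meets hpi (@p_closure i).
  exists (Some (val u)); split; first exact: valP u.
  by exists i; rewrite epoint_in.
have [w hw] := choice exW.
have hw0 := hw; have {}hw e t : w e = Some t ->
    0 < t < 1 /\ exists i, edge_interior e (p i) /\ ee i (epoint e t).
  by move=> et; have := hw e; rewrite et.
(* Each half of a punctured edge follows the vertex at its end; an unpunctured edge follows its
   source, which is on the same side as its target. *)
pose he (B : set (vertex G)) e t : Prop :=
  if w e is Some s then (t < s /\ B (src e)) \/ (s < t /\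
    B (tgt e)) else B (src e).
pose Us B : set Gam := glue (fun v => B v) (he B).
have none e : w e = None -> A (src e) <-> A (tgt e).
  by move=> we; apply: hA; have := hw0 e; rewrite we.
have UsE (B : set (vertex G)) e t : (w e = None -> B (src e) <-> B (tgt e)) ->
  0 <= t <= 1 ->
    Us B (epoint e t) = he B e t.
  move=> BE ht; apply: glueE => //; rewrite /he; case we: (w e) => [s|//].
  - have [/andP[s0 s1] _] := hw e s we; apply/propext; split; last by left.
    by case=> -[] //; lra.
  - have [/andP[s0 s1] _] := hw e s we; apply/propext; split; last by right.
    by case=> -[] //; lra.
  - by apply/propext; exact: BE.
have oUs (B : set (vertex G)) : (forall e, w e = None -> B (src e) <->
  B (tgt e)) -> open (Us B).
  move=> BE; apply/open_mgraphP => e s hs; rewrite UsE//; last exact: BE.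
  rewrite /he => hUs; have : \forall t \near s, he B e t.
    move: hUs; rewrite /he; case we: (w e) => [r|] h; last by near=> t.
    case: h => -[sr Bv]; near=> t; [left|right]; split=> //; near: t.
      exact: lt_nbhsl.
    exact: lt_nbhsr.
  by apply: filterS => t het ht; rewrite UsE//; exact: BE.
pose Q : set Gam := [set x | exists e t, w e = Some t /\ x = epoint e t].
have noneC e : w e = None -> (~` A) (src e) <-> (~` A) (tgt e).
  by move=> /none he0; split=> nA Ax; apply: nA; apply/he0.
have [||||||U0|V0] := @punctured_connected Q (Us A) (Us (~` A)).
- move=> _ [e [t [/hw[ht [i [_ it]]] ->]]]; split; last by exists i.
  by exists e; rewrite epointE; eexists.
- move=> i _ _ [e [t [we ->]]] [e' [t' [we' ->]]].
  have [_ [j [hpj jt]]] := hw e t we; have [_ [j' [hpj' jt']]] := hw e' t' we'.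
  move=> it it'; rewrite (ee_disj jt it) in hpj;
    rewrite (ee_disj jt' it') in hpj'.
  have ee' : e = e' by case: hpj hpj' => u -> [u' [->]].
  by move: we'; rewrite -ee' we => -[->].
- by apply: oUs; exact: none.
- by apply: oUs; exact: noneC.
- apply/seteqP; split=> // -[v|[e u]]; rewrite /Us/=; first by move=> [].
  rewrite /he; case: (w e) => [s|]; last by move=> [].
  by move=> [] [] [? ?] [] [? ?]; try lra.
- apply/seteqP; split=> -[v|[e u]].
  + move=> _ [e [t [/hw[ht _]]]]; by rewrite (epointE _ ht).
  + have hu := valP u; rewrite /Us /= /he => h [e' [t [we]]].
    have [ht _] := hw _ _ we; rewrite (epointE _ ht) => -[ee' ut].
    by move: h; rewrite ee' we ut /= ltxx => -[] [] [].
  + by move=> _; rewrite /Us /=; exact: EM.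
  + move=> nQ; rewrite /Us /= /he; case we: (w e) => [s|]; last exact: EM.
    have [us|su|us] := ltgtP (val u) s.
    * by have [As|nAs] := EM (A (src e)); [left; left|right; left]; split=> //;
      exact: nAs.
    * by have [At|nAt] := EM (A (tgt e)); [left; right|right; right]; split=> //;
      exact: nAt.
    * by case: nQ; exists e, s; split=> //; rewrite -us epoint_in.
- by have : Us A (vpoint v0) by []; rewrite U0.
- move=> v; apply: contrapT => nAv.
  by have : Us (~` A) (vpoint v) by []; rewrite V0.
Unshelve. all: by end_near. Qed.

End Break.
End BreakSegments.

(** * Rational functions *)

Section Slopes.
Context {R : realType}.
Implicit Types (g : R -> R) (a b t u : R) (m : int).

(** Both slopes are taken in the direction of increasing parameter, so the outgoing slope to the
    left is the negative of [left_slope]. *)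
Definition right_slope g t m : Prop :=
  \forall h \near 0^'+, g (t + h) = g t + m%:~R * h.
Definition left_slope g t m : Prop :=
  \forall h \near 0^'+, g (t - h) = g t - m%:~R * h.
Definition affine_on g a b m : Prop :=
  forall t, a <= t <= b -> g t = g a + m%:~R * (t - a).

Lemma affine_right_slope g a b m t : affine_on g a b m -> a <= t < b ->
  right_slope g t m.
Proof.
move=> gm /andP[a_t tb]; near=> h.
have h0 : 0 < h by near: h; exact: nbhs_right_gt.
have hb : h < b - t by near: h; apply: nbhs_right_lt; rewrite subr_gt0.
rewrite (gm (t + h)); last by lra.
by rewrite (gm t); [ring|lra].
Unshelve. all: by end_near. Qed.

Lemma affine_left_slope g a b m t : affine_on g a b m -> a < t <= b ->
  left_slope g t m.
Proof.
move=> gm /andP[a_t tb]; near=> h.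
have h0 : 0 < h by near: h; exact: nbhs_right_gt.
have ha : h < t - a by near: h; apply: nbhs_right_lt; rewrite subr_gt0.
rewrite (gm (t - h)); last by lra.
by rewrite (gm t); [ring|lra].
Unshelve. all: by end_near. Qed.

Definition pieces g a (s : seq R) : Prop := forall i, (i < size s)%N ->
  exists m, affine_on g (nth 0 (a :: s) i) (nth 0 (a :: s) i.+1) m.

Lemma pieces_cons g a x (s : seq R) : pieces g a (x :: s) ->
  (exists m, affine_on g a x m) /\ pieces g x s.
Proof. by move=> ps; split; [exact: (ps 0%N)|move=> i; exact: (ps i.+1)]. Qed.

Lemma pieces_slopes g a b s t : itv_partition a b s -> pieces g a s ->
  (a <= t < b -> exists m, right_slope g t m) /\
  (a < t <= b -> exists m, left_slope g t m).
Proof.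
elim: s a => [|x s IH] a abs.
  by rewrite (itv_partition_nil abs) => _; split; lra.
have xbs := itv_partition_cons abs; have ax : a < x by case: abs => /andP[].
have xb := itv_partition_le xbs.
move=> /pieces_cons[[m gm] /(IH _ xbs)[IHr IHl]]; split=> ht.
  have [tx|xt] := ltP t x; last by apply: IHr; lra.
  by exists m; apply: affine_right_slope gm _; lra.
have [xt|tx] := ltP x t; first by apply: IHl; lra.
by exists m; apply: affine_left_slope gm _; lra.
Qed.

(** The slope drops by one at [u] and is constant elsewhere, so for [u] inside the increment is m (u
    - a) + (m - 1) (b - u). The flag [k] tells whether [u] is inside; otherwise [g] has slope [m]
    throughout. *)
Lemma pieces_increment g a b s (u : R) : itv_partition a b s -> a < b ->
  pieces g a s ->
  (forall t m m', a < t < b -> left_slope g t m -> right_slope g t m' ->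
     m - m' = Posz (t == u)) ->
  exists m, let k := Posz (a < u < b)%R in [/\ right_slope g a m,
    left_slope g b (m - k) &
    g b - g a = (m - k)%:~R * b - m%:~R * a + k%:~R * u].
Proof.
elim: s a => [|x s IH] a abs ab; first by have := itv_partition_nil abs; lra.
have xbs := itv_partition_cons abs; have ax : a < x by case: abs => /andP[].
have xb := itv_partition_le xbs.
move=> /pieces_cons[[m gm] ps] jump.
have ra : right_slope g a m by apply: affine_right_slope gm _; lra.
have lx : left_slope g x m by apply: affine_left_slope gm _; lra.
have gx : g x = g a + m%:~R * (x - a) by apply: gm; lra.
(* Inside an affine piece the left and right slopes agree, so the drop can only occur at a
   breakpoint. *)
have u_out : ~ a < u < x.
  move=> hu; have := jump u m m; rewrite subrr eqxx => /(_ _ _ _)/wrap[] //.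
  - by lra.
  - by apply: affine_left_slope gm _; lra.
  - by apply: affine_right_slope gm _; lra.
have [xbe|xb'] := eqVneq x b.
  have -> : (a < u < b)%R = false by apply/negP; rewrite -xbe.
  exists m; rewrite /= (subr0 m) -xbe gx; split=> //; ring.
have {xb xb'}xb : x < b by rewrite lt_neqAle xb'.
have [|m1 [r1 l1 inc]] := IH x xbs xb ps.
  by move=> t k k' ht; apply: jump; lra.
have := jump x m m1; rewrite ax xb => /(_ isT lx r1) mm1.
have uk : Posz (a < u < b)%R = Posz (x == u) + Posz (x < u < b)%R.
  have [xu|ux|<-] := ltgtP x u; rewrite ?andbF ?andbT ?add0r.
  - by rewrite (lt_trans ax xu).
  - have -> : (a < u)%R = false by apply/negP => au; apply: u_out; rewrite au.
    by [].
  - by rewrite ax xb.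
exists m; move=> k; rewrite /k; split=> //.
  by have -> : m - Posz (a < u < b)%R = m1 - Posz (x < u < b)%R by rewrite uk
    -mm1; ring.
have -> : g b - g a = (g b - g x) + (g x - g a) by ring.
rewrite inc gx uk -mm1; have -> : m1 = m - Posz (x == u) by rewrite -mm1; ring.
rewrite !rmorphD/= !rmorphN /=; case: eqVneq => [->|_] /=; rewrite ?mulr0z; ring.
Qed.

End Slopes.

(** * Divisors of rational functions, and integrality of semibreak divisors *)

Section RationalFunctions.
Context {R : realType} {G : graph}.
Local Notation Gam := (mgraph R G).
Implicit Types (e : edge G) (v : vertex G) (x y : Gam) (phi : Gam -> R) (D E :
  divisor R G).

Local Notation on_edge phi e := (fun t : R => phi (epoint e t)).

Lemma outgoing_slopeE phi (ray : R -> Gam) (m : R) :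
  (\forall h \near 0^'+, phi (ray h) = phi (ray 0) + m * h) ->
    outgoing_slope phi ray = m.
Proof.
move=> hm; rewrite /outgoing_slope; apply: lim_near_cst => //; near=> h.
have h0 : 0 < h by near: h; exact: nbhs_right_gt.
have -> : phi (ray h) = phi (ray 0) + m * h by near: h.
by rewrite addrC addKr mulfK// gt_eqF.
Unshelve. all: by end_near. Qed.

Lemma div_coeff_inner phi e (u : {t : R | 0 < t < 1}) (m m' : int) :
  left_slope (on_edge phi e) (val u) m -> right_slope (on_edge phi e) (val u) m'
    ->
  div_coeff phi (inr (e, u)) = (m - m')%:~R.
Proof.
move=> lm rm; rewrite /div_coeff /rays big_cons big_seq1.
rewrite (@outgoing_slopeE _ _ m'%:~R); last first.
  by move: rm; apply: filterS => h ->; rewrite addr0.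
rewrite (@outgoing_slopeE _ _ (- m%:~R)); last first.
  by move: lm; apply: filterS => h ->; rewrite subr0 mulNr.
by rewrite rmorphB opprD opprK addrC.
Qed.

Lemma div_coeff_vertex phi v (rs ls : edge G -> int) :
  (forall e, right_slope (on_edge phi e) 0 (rs e)) ->
  (forall e, left_slope (on_edge phi e) 1 (ls e)) ->
  div_coeff phi (vpoint v) =
  (\sum_(e | tgt e == v) ls e - \sum_(e | src e == v) rs e)%:~R.
Proof.
move=> hr hl; rewrite /div_coeff /rays /= big_cat !big_map !big_filter
  !big_enum_cond /=.
under eq_bigr => e _.
  rewrite (@outgoing_slopeE _ _ (rs e)%:~R); last first.
    by move: (hr e); apply: filterS => h; rewrite add0r => ->.
  over.
under [X in _ + X]eq_bigr => e _.
  rewrite (@outgoing_slopeE _ _ (- (ls e)%:~R)); last first.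
    by move: (hl e); apply: filterS => h ->; rewrite subr0 mulNr.
  over.
by rewrite rmorphB !rmorph_sum sumrN opprD opprK addrC.
Qed.

Lemma rational_pieces phi e : piecewise_affine phi ->
  exists2 s, itv_partition 0 1 s & pieces (on_edge phi e) 0 s.
Proof. by move=> /(_ e)[s ps hs]; exists s. Qed.

Lemma rational_slopes phi : piecewise_affine phi -> exists rs ls : edge G -> int,
  (forall e, right_slope (on_edge phi e) 0 (rs e)) /\
  (forall e, left_slope (on_edge phi e) 1 (ls e)).
Proof.
move=> pa; have hr e : exists m, right_slope (on_edge phi e) 0 m.
  have [s ps hs] := rational_pieces e pa.
  by apply: (pieces_slopes 0 ps hs).1; rewrite lexx ltr01.
have hl e : exists m, left_slope (on_edge phi e) 1 m.
  have [s ps hs] := rational_pieces e pa.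
  by apply: (pieces_slopes 1 ps hs).2; rewrite lexx ltr01.
by have [rs hrs] := choice hr; have [ls hls] := choice hl; exists rs, ls.
Qed.

Lemma rational_inner_slopes phi e (t : R) : piecewise_affine phi -> 0 < t < 1 ->
  exists m m', left_slope (on_edge phi e) t m /\ right_slope (on_edge phi e) t m'.
Proof.
move=> pa /andP[t0 t1]; have [s ps hs] := rational_pieces e pa.
have [hr hl] := pieces_slopes t ps hs.
have [|m' hm'] := hr; first by rewrite ltW.
by have [|m hm] := hl; [rewrite t0 ltW|exists m, m'].
Qed.

(** A value of [u] outside the open unit interval encodes an edge whose interior carries no chip. *)
Lemma edge_increment phi E e (u : R) : piecewise_affine phi ->
  (forall x, (coeff x E)%:~R = div_coeff phi x) ->
  (forall t, 0 < t < 1 -> coeff (epoint e t) E = Posz (t == u)) ->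
  exists m, let k := Posz (0 < u < 1)%R in
    [/\ right_slope (on_edge phi e) 0 m, left_slope (on_edge phi e) 1 (m - k) &
    phi (vpoint (tgt e)) - phi (vpoint (src e)) = (m - k)%:~R + k%:~R * u].
Proof.
move=> pa hE hc; have [s ps hs] := rational_pieces e pa.
have [|m [rm lm inc]] := pieces_increment ps ltr01 hs (u := u).
  move=> t m m' ht lm rm; rewrite -hc//; apply/(@intr_inj R).
  rewrite hE (epointE _ ht); apply/esym/div_coeff_inner => //.
exists m; split=> //; move: inc; rewrite /= epoint0 epoint1 => ->.
by rewrite mulr1 mulr0 subr0.
Qed.

Lemma coeff_sum_points (n : nat) (p : 'I_n -> Gam) x :
  coeff x (\sum_i << p i >> : divisor R G) = \sum_i Posz (p i == x).
Proof. by rewrite raddf_sum; apply: eq_bigr => i _; apply: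
  etrans (coeffU _ _ _) _; rewrite mul1r natz. Qed.

Lemma semibreak_integral D E : integral_divisor D -> linear_equiv E D ->
  semibreak_divisor E -> integral_divisor E.
Proof.
move=> intD [phi [_ pa] hphi] [effE [B [p [ee [BE hee ee_triv ee_contr]]] effBE]]
  x Ex.
have ee_seg i := (hee i).1; have p_cl i := (hee i).2.
case: x Ex => [v _|[e0 u0] Ex]; first by exists v.
exfalso; have coeffD e (t : R) : 0 < t < 1 -> coeff (epoint e t) D = 0.
  move=> ht; apply/eqP; apply: contraT => /intD[v]; by rewrite (epointE _ ht).
have le_B y : coeff y E <= \sum_i Posz (p i == y).
  by have := effBE y; rewrite coeffB BE coeff_sum_points subr_ge0.
have pos_B y : coeff y E != 0 -> exists i, p i = y.
  move=> Ey; apply: contrapT => np; move: (le_B y); rewrite big1 => [le0|i _].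
    by move/negP: Ey; apply; rewrite eq_le le0; exact: effE.
  by case: eqP => // py; case: np; exists i.
have [i0 pi0] := pos_B _ Ex.
have inner_coeff e (u : R) :
    (forall t, 0 < t < 1 -> coeff (epoint e t) E = Posz (t == u)) ->
  forall t, 0 < t < 1 -> coeff (epoint e t) (E - D) = Posz (t == u).
  by move=> hE t ht; rewrite coeffB coeffD// subr0 hE.
(* The vertices where [phi] agrees modulo 1 with its value at the source of [e0]. Edges without an
   interior [p i] preserve this class, so it contains all vertices. *)
pose A : set (vertex G) := [set v | exists z : int,
  phi (vpoint v) - phi (vpoint (src e0)) = z%:~R].
have A0 : A (src e0) by exists 0; rewrite subrr.
have Aall := punctured_vertices ee_seg ee_triv ee_contr p_cl A0.
have [z hz] : A (tgt e0).
  apply: Aall => e noi.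
  (* The parameter 2 lies off the edge: no chip inside. *)
  have [|m [_ _ inc]] := @edge_increment phi (E - D) e 2 pa hphi.
    apply: inner_coeff => t ht; have -> : (t == 2) = false by apply/eqP; lra.
    apply/eqP; apply: contraT => /pos_B[i pit]; case: noi; exists i.
    by rewrite pit (epointE _ ht); eexists.
  move: inc; have -> : ((0 < (2 : R) < 1)%R) = false by apply/negP; lra.
  rewrite mul0r addr0 subr0 => inc.
  split=> -[z hz]; [exists (z + m)|exists (z - m)].
    by rewrite rmorphD/= -hz -inc; ring.
  by rewrite rmorphB/= -hz -inc; ring.
have hu := valP u0; rewrite /= in hu.
(* By [interior_index_inj], [i0] is the only index with its point inside [e0], so [E] has exactly
   one chip there. *)
have [|m [_ _ inc]] := @edge_increment phi (E - D) e0 (val u0) pa hphi.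
  apply: inner_coeff => t ht; have [tu|tu] := eqVneq t (val u0).
    rewrite tu epoint_in; apply/le_anti/andP; split.
      apply: (le_trans (le_B _)); rewrite (bigD1 i0)//= pi0 eqxx big1 ?addr0// =>
        i ni.
      case: eqP => // hpi; move/eqP: ni; case.
      apply: (interior_index_inj ee_seg ee_triv ee_contr p_cl (e := e0)).
        by rewrite hpi; eexists.
      by rewrite pi0; eexists.
    by have := effE (inr (e0, u0)); move: Ex; case: (coeff _ _) => [[|n]|].
  apply/eqP; apply: contraT => /pos_B[i pit]; exfalso.
  have ii0 : i = i0.
    apply: (interior_index_inj ee_seg ee_triv ee_contr p_cl (e := e0)).
      by rewrite pit (epointE _ ht); eexists.
    by rewrite pi0; eexists.
  move: pit; rewrite ii0 pi0 -epoint_in => /esym /(epoint_inj ht)[_ tE].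
  by rewrite tE eqxx in tu.
(* The increment along [e0] is an integer plus [val u0] and is itself an integer, so an integer
   would lie strictly between 0 and 1. *)
move: inc; rewrite hz hu mul1r => /eqP; rewrite addrC -subr_eq -rmorphB/= =>
  /eqP zE.
move: hu; rewrite -zE -[0]/(0%:~R) -[1]/(1%:~R) !ltr_int; lia.
Qed.

End RationalFunctions.

(** * Integral semibreak divisors *)

Section Firing.
Context {R : realType} {G : graph}.
Local Notation Gam := (mgraph R G).
Implicit Types (e : edge G) (v : vertex G) (x y : Gam) (phi psi : Gam -> R)
  (f : vertex G -> int) (D E : divisor R G).

Definition fire_edge f e (t : R) : R :=
  (f (src e))%:~R + (f (tgt e) - f (src e))%:~R * t.

Definition fire f : Gam -> R := glue (fun v => (f v)%:~R) (fire_edge f).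

Lemma fireE f e (t : R) : 0 <= t <= 1 -> fire f (epoint e t) = fire_edge f e t.
Proof.
apply: glueE; rewrite /fire_edge; first by rewrite mulr0 addr0.
by rewrite mulr1 rmorphB addrC subrK.
Qed.

Lemma fire_continuous f : continuous (fire f).
Proof.
apply: (@continuous_mgraph _ _ _ _ (fire_edge f)) => [e t|e t]; last exact: fireE.
by apply: cvgD; [exact: cvg_cst|apply: cvgM; [exact: cvg_cst|exact: cvg_id]].
Qed.

(** Since [fire f] is affine on every closed edge, the partition given for [phi] also serves for the
    difference. *)
Lemma sub_fire_rational phi f : rational_function phi ->
  rational_function (fun x => fire f x - phi x).
Proof.
move=> [cphi pa]; split=> [x|e].
  by apply: (@continuousB _ R^o); [exact: fire_continuous|exact: cphi].
have [s ps hs] := pa e; exists s => // i i_lt; have [m hm] := hs i i_lt.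
exists (f (tgt e) - f (src e) - m) => a b t /= ht.
have a0 : 0 <= a.
  rewrite /a (set_nth_default 1); last by rewrite /= ltnS ltnW.
  by apply: (@itv_partition_nth_ge _ _ 0 1 s i _ ps); rewrite ltnS ltnW.
have b1 : b <= 1.
  rewrite /b (set_nth_default 1)//.
  exact: (@itv_partition_nth_le _ _ 0 1 s i.+1 _ ps).
rewrite !fireE; [|lra..].
have hmt : phi (epoint e t) = phi (epoint e a) + m%:~R * (t - a) := hm t ht.
by rewrite hmt /fire_edge !rmorphB /=; ring.
Qed.

Lemma slope_sub (g h : R -> R) (t : R) (m n : int) :
  (right_slope g t m -> right_slope h t n -> right_slope (fun s =>
    g s - h s) t (m - n)) /\
  (left_slope g t m -> left_slope h t n -> left_slope (fun s =>
    g s - h s) t (m - n)).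
Proof.
by split; apply: filterS2 => s /= -> ->; rewrite rmorphB; ring.
Qed.

Lemma div_coeffB phi psi x : piecewise_affine phi -> piecewise_affine psi ->
  div_coeff (fun y => phi y - psi y) x = div_coeff phi x - div_coeff psi x.
Proof.
move=> pphi ppsi; case: x => [v|[e u]].
  have [rs [ls [hr hl]]] := rational_slopes pphi.
  have [rs' [ls' [hr' hl']]] := rational_slopes ppsi.
  rewrite (div_coeff_vertex v hr hl) (div_coeff_vertex v hr' hl').
  rewrite (@div_coeff_vertex _ _ _ v (fun e => rs e - rs' e) (fun e =>
    ls e - ls' e)).
  - by rewrite -rmorphB; congr (_%:~R); rewrite !sumrB; ring.
  - by move=> e; apply: (slope_sub _ _ _ _ _).1.
  - by move=> e; apply: (slope_sub _ _ _ _ _).2.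
have [m [m' [lm rm]]] := rational_inner_slopes e pphi (valP u).
have [n [n' [ln rn]]] := rational_inner_slopes e ppsi (valP u).
rewrite (div_coeff_inner lm rm) (div_coeff_inner ln rn).
rewrite (div_coeff_inner ((slope_sub _ _ _ _ _).2 lm ln) ((slope_sub _ _ _ _ _).1
  rm rn)).
by rewrite -rmorphB; congr (_%:~R); ring.
Qed.

Lemma fire_affine f e : affine_on (fun t : R =>
  fire f (epoint e t)) 0 1 (f (tgt e) - f (src e)).
Proof.
move=> t ht; rewrite !fireE ?lexx ?ler01//.
by rewrite /fire_edge subr0 mulr0 addr0.
Qed.

Lemma fire_rational f : rational_function (fire f).
Proof.
split; first exact: fire_continuous.
move=> e; exists [:: 1]; first exact: itv_partition1.
by case=> // _; exists (f (tgt e) - f (src e)); exact: fire_affine.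
Qed.

Lemma div_coeff_fire f x : div_coeff (fire f) x =
  (if x is inl v then lap f v else 0)%:~R.
Proof.
case: x => [v|[e u]].
  rewrite (@div_coeff_vertex _ _ _ v (fun e => f (tgt e) - f (src e)) (fun e =>
    f (tgt e) - f (src e))).
  - congr (_%:~R); rewrite addrC /lap -sumrN; congr (_ + _); apply: eq_bigr =>
    e /eqP <- //.
    by rewrite opprB.
  - by move=> e; apply: affine_right_slope (fire_affine f e) _;
    rewrite lexx ltr01.
  - by move=> e; apply: affine_left_slope (fire_affine f e) _; rewrite lexx ltr01.
have hu := valP u; rewrite /= in hu; have /andP[u0 u1] := hu.
rewrite (div_coeff_inner (affine_left_slope (fire_affine f e) (t := val u) _)
  (affine_right_slope (fire_affine f e) (t := val u) _)) ?subrr//.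
  by rewrite u0 ltW.
by rewrite u1 ltW.
Qed.

Lemma linear_equiv_fire D D' E f : linear_equiv D D' ->
  (forall x, coeff x (E - D') = if x is inl v then lap f v else 0) ->
    linear_equiv E D.
Proof.
move=> [phi rphi hphi] hE; exists (fun x => fire f x - phi x); first exact:
  sub_fire_rational.
move=> x; rewrite div_coeffB; [|exact: (fire_rational f).2|exact: rphi.2].
rewrite div_coeff_fire -hE -hphi -rmorphB; congr (_%:~R).
by rewrite !coeffB; ring.
Qed.

Definition vertex_divisor (c : vertex G -> int) : divisor R G :=
  \sum_v << c v *g (vpoint v : Gam) >>.

Lemma coeff_vertex_divisor c x :
  coeff x (vertex_divisor c) = if x is inl v then c v else 0.
Proof.
rewrite raddf_sum.
have cE v : coeff x << c v *g (vpoint v : Gam) >> = c v * ((vpoint v :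
  Gam) == x)%:R.
  exact: coeffU.
rewrite (eq_bigr _ (fun v _ => cE v)); case: x {cE} => [w|[e u]]; last first.
  by apply: big1 => v _; rewrite mulr0.
rewrite (bigD1 w)//= eqxx mulr1 big1 ?addr0// => v vw.
by rewrite (_ : (vpoint v == inl w) = false) ?mulr0//; apply/eqP => -[/eqP];
  rewrite (negPf vw).
Qed.

Lemma integral_divisorE D : integral_divisor D ->
  D = vertex_divisor (fun v => coeff (vpoint v : Gam) D).
Proof.
move=> intD; apply/eqP/freeg_eqP => x; rewrite coeff_vertex_divisor.
case: x => [//|[e u]]; apply/eqP; apply: contraT => /intD[v]; by [].
Qed.

Lemma deg_integral D : integral_divisor D -> deg D = \sum_v coeff (vpoint v :
  Gam) D.
Proof.
move=> intD; rewrite {1}(integral_divisorE intD) raddf_sum.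
by apply: eq_bigr => v _; exact: degU.
Qed.

(** With no chips inside the edges, [phi] has the same slope at both ends of each edge, and this
    slope enters the total once with each sign. *)
Lemma equivalent_degree D D' : integral_divisor D -> integral_divisor D' ->
  linear_equiv D D' -> \sum_v coeff (vpoint v :
    Gam) D' = \sum_v coeff (vpoint v : Gam) D.
Proof.
move=> intD intD' [phi rphi hphi].
have coeff0 (B : divisor R G) e (t : R) : integral_divisor B -> 0 < t < 1 ->
  coeff (epoint e t) B = 0.
  move=> intB ht; apply/eqP; apply: contraT => /intB[v];
    by rewrite (epointE _ ht).
have slopes e : exists m, right_slope (fun t : R => phi (epoint e t)) 0 m /\
    left_slope (fun t : R => phi (epoint e t)) 1 m.
  have [|m [rm lm _]] := @edge_increment _ _ phi (D - D') e 2 rphi.2 hphi.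
    by move=> t ht; rewrite coeffB !coeff0// subrr; case: eqVneq => [t2|//];
      exfalso; lra.
  exists m; split=> //; move: lm.
  by have -> : ((0 < (2 : R) < 1)%R) = false by [apply/negP; lra]; rewrite subr0.
have [s hs] := choice slopes.
apply/eqP; rewrite eq_sym -subr_eq0 -sumrB; apply/eqP/(@intr_inj R).
rewrite rmorph_sum/=; under eq_bigr => v _.
  rewrite -coeffB hphi (div_coeff_vertex v (fun e => (hs e).1) (fun e =>
    (hs e).2)).
  over.
rewrite -rmorph_sum sumrB; congr (_%:~R).
by rewrite !(@sum_fiber _ _ _ _ (fun e _ => s e)) subrr.
Qed.

End Firing.

(** * Contractibility of a spanning tree *)

Section TreeContraction.
Context {R : realType} {G : graph}.
Local Notation Gam := (mgraph R G).
Implicit Types (e : edge G) (u v : vertex G) (x y : Gam).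

Variables (rho : vertex G) (depth : vertex G -> nat)
  (par : vertex G -> option (vertex G * edge G)).
Hypothesis depth_rho : depth rho = 0%N.
Hypothesis parP : forall v, v != rho -> exists u e,
  [/\ par v = Some (u, e), depth v = (depth u).+1 &
    (src e = u /\ tgt e = v) \/ (tgt e = u /\ src e = v)].

Definition tree_edge e : Prop := exists u v, v != rho /\ par v = Some (u, e).

Definition tree : set Gam := [set x | if x is inr (e,
  _) then tree_edge e else True].

(** The point of [e] at distance [s] from its end [u]. For a tree edge the ends have different
    depths, so the test on the source identifies the right end. *)
Definition branch e u (s : R) : Gam := epoint e (if src e == u then s else 1 - s).

(** [n] is meant to be the depth of [v]: up to time n - 1 the path is that of the parent, and then
    it runs along the last edge. *)
Fixpoint geod_rec (n : nat) v (h : R) : Gam :=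
  if n is n'.+1 then
    if par v is Some (u, e) then
      if h <= n'%:R then geod_rec n' u h else branch e u (h - n'%:R)
    else vpoint v
  else vpoint v.

(* The unit-speed path from rho to v in the tree, constant after time depth v. *)
Definition geod v (h : R) : Gam := geod_rec (depth v) v h.

Lemma geod_rho h : geod rho h = vpoint rho.
Proof. by rewrite /geod depth_rho. Qed.

Lemma parE v u e : v != rho -> par v = Some (u, e) -> [/\ depth v = (depth u).+1,
  branch e u 0 = vpoint u, forall s, 1 <= s -> branch e u s = vpoint v &
  (src e = u /\ tgt e = v) \/ (tgt e = u /\ src e = v)].
Proof.
move=> vr pv; have [u' [e' [pv' dv ev]]] := parP vr.
move: pv'; rewrite pv => -[uu ee]; rewrite -{}uu -{}ee in dv ev.
have nuv : (v == u) = false by apply/eqP => uv; move: dv; rewrite uv => /n_Sn.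
split=> //; rewrite /branch; case: ev => -[eu ev]; rewrite ?eu ?eqxx ?ev ?nuv.
- by rewrite -eu epoint0.
- by rewrite subr0 epoint1 eu.
- by move=> s s1; rewrite epoint_ge1// ev.
- by move=> s s1; rewrite epoint_le0 ?ev// subr_le0.
Qed.

Lemma geodE v u e h : v != rho -> par v = Some (u, e) ->
  geod v h = if h <= (depth u)%:R then geod u h else branch e u (h - (depth
    u)%:R).
Proof. by move=> vr pv; have [dv _ _ _] := parE vr pv; rewrite /geod dv /= pv.
  Qed.

Lemma depth_ind (P : vertex G -> Prop) : P rho ->
  (forall v u e, v != rho -> par v = Some (u, e) -> P u -> P v) -> forall v, P v.
Proof.
move=> P0 PS v; have [n] := ubnP (depth v); elim: n v => // n IH v.
have [->//|vr] := eqVneq v rho.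
have [u [e [pv dv _]]] := parP vr; rewrite dv ltnS => dn.
exact: PS vr pv (IH u dn).
Qed.

Lemma geod_end v (h : R) : (depth v)%:R <= h -> geod v h = vpoint v.
Proof.
have [->|vr] := eqVneq v rho; first by rewrite geod_rho.
have [u [e [pv _ _]]] := parP vr; have [dv _ b1 _] := parE vr pv.
rewrite dv (geodE _ vr pv) -natr1 => hh; case: ifPn => [/(le_trans hh)|_];
  first by rewrite gerDl ler10.
by apply: b1; rewrite lerBrDl.
Qed.

Lemma geod0 v (h : R) : h <= 0 -> geod v h = vpoint rho.
Proof.
move=> h0; elim/depth_ind: v => [|v u e vr pv IH]; first exact: geod_rho.
by rewrite (geodE _ vr pv) (le_trans h0).
Qed.

Lemma geod_lip v (h k : R) : mdist (geod v h) (geod v k) <= `|h - k|.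
Proof.
wlog hk : h k / h <= k.
  move=> wl; have [/wl//|/ltW/wl] := leP h k.
  by rewrite metric_sym distrC.
elim/depth_ind: v h k hk => [|v u e vr pv IH] h k hk.
  by rewrite !geod_rho mdistxx.
have [dv b0 _ _] := parE vr pv; rewrite !(geodE _ vr pv).
have blip (s t : R) : mdist (branch e u s) (branch e u t) <= `|s - t|.
  apply: (le_trans (mdist_epoint _ _ _)); case: ifP => // _.
  by rewrite (_ : 1 - s - (1 - t) = t - s) 1?distrC//; ring.
have [hu|uh] := leP h (depth u)%:R; have [ku|uk] := leP k (depth u)%:R.
- exact: IH.
- apply: le_trans (metric_triangle _ (vpoint u) _) _.
  rewrite -{1}(@geod_end u (depth u)%:R)// -b0.
  apply: le_trans (lerD (IH _ _ hu) (blip _ _)) _.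
  rewrite !ler0_norm; lra.
- by lra.
- by apply: le_trans (blip _ _) _; rewrite opprB addrA subrK.
Qed.

Lemma tree_epoint e (s : R) : tree_edge e -> tree (epoint e s).
Proof. by move=> te; rewrite /epoint; case: insubP => [w _ _|_]. Qed.

Lemma geod_tree v (h : R) : tree (geod v h).
Proof.
elim/depth_ind: v => [|v u e vr pv IH]; first by rewrite geod_rho.
rewrite (geodE _ vr pv); case: ifP => // _.
by apply: tree_epoint; exists u, v.
Qed.

Lemma geod_min v (h : R) : geod v (Num.min h (depth v)%:R) = geod v h.
Proof.
have [hv|vh] := leP h (depth v)%:R => //.
by rewrite !geod_end// ltW.
Qed.

Lemma geod_min_par v u e (h : R) : v != rho -> par v = Some (u, e) ->
  geod v (Num.min h (depth u)%:R) = geod u h.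
Proof.
by move=> vr pv; rewrite (geodE _ vr pv) ge_min lexx orbT geod_min.
Qed.

(** If an edge led to the parent from both of its ends, each of the two depths would exceed the
    other by one. *)
Lemma par_inj v v' u u' e : v != rho -> v' != rho ->
  par v = Some (u, e) -> par v' = Some (u', e) -> v = v'.
Proof.
move=> vr vr' pv pv'; have [dv _ _ ev] := parE vr pv; have [dv' _ _ ev'] :=
  parE vr' pv'.
case: ev ev' => -[h1 h2] [] [h1' h2'].
- by rewrite -h2.
- move: dv dv'; rewrite -h1 -h2 -h1' -h2' => d1; rewrite d1 => /eqP;
  rewrite -addn2 -[X in X == _]addn0 eqn_add2l//.
- move: dv dv'; rewrite -h1 -h2 -h1' -h2' => d1; rewrite d1 => /eqP;
  rewrite -addn2 -[X in X == _]addn0 eqn_add2l//.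
- by rewrite -h2.
Qed.

Definition child e : option (vertex G * vertex G) :=
  if [pick v | (v != rho) && (omap snd (par v) == Some e)] is Some v then
    if par v is Some (u, _) then Some (u, v) else None
  else None.

Lemma childP v u e : v != rho -> par v = Some (u, e) -> child e = Some (u, v).
Proof.
move=> vr pv; rewrite /child; case: pickP => [v' /andP[vr']|/(_ v)];
  last by rewrite vr pv /= eqxx.
case pv' : (par v') => [[u' e']|//] /eqP /= [ee]; rewrite ee in pv'.
have vv := par_inj vr vr' pv pv'; move: pv'; rewrite -vv pv => -[->]//.
Qed.

(* The point at height at most h on the tree path from rho to x. *)
Definition descend x (h : R) : Gam :=
  match x with
  | inl v => geod v h
  | inr (e, w) => if child e is Some (u, v) then
      geod v (Num.min h ((depth u)%:R + (if src e == u then val w else 1 - val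
        w)))
    else vpoint rho
  end.

(** One formula for the whole closed edge, vertices included, on which the Lipschitz estimate
    rests. *)
Lemma descendE v u e (t h : R) : v != rho -> par v = Some (u, e) -> 0 <= t <= 1 ->
  descend (epoint e t) h =
  geod v (Num.min h ((depth u)%:R + (if src e == u then t else 1 - t))).
Proof.
move=> vr pv; have [dv _ _ ev] := parE vr pv.
have nuv : (v == u) = false by apply/eqP => uv; move: dv; rewrite uv => /n_Sn.
have dv1 : (depth u)%:R + 1 = (depth v)%:R :> R by rewrite dv natr1.
case/unit_itvP => [->|->|ht].
- rewrite epoint0 /=; case: ev => -[eu etv]; rewrite ?eu ?etv ?eqxx ?nuv.
    by rewrite addr0 (geod_min_par _ vr pv).
  by rewrite subr0 dv1 geod_min.
- rewrite epoint1 /=; case: ev => -[eu etv]; rewrite ?eu ?etv ?eqxx ?nuv.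
    by rewrite dv1 geod_min.
  by rewrite subrr addr0 (geod_min_par _ vr pv).
- by rewrite (epointE _ ht) /= (childP vr pv).
Qed.

Lemma descend_tree x (h : R) : tree (descend x h).
Proof.
case: x => [v|[e w]] /=; first exact: geod_tree.
by case: (child e) => [[u v]|//]; exact: geod_tree.
Qed.

Let N : nat := \max_v depth v.

Lemma descend_top x : tree x -> descend x N%:R = x.
Proof.
have leN v : (depth v)%:R <= N%:R :> R by rewrite ler_nat leq_bigmax.
case: x => [v _|[e w] [u [v [vr pv]]]]; first by rewrite /= geod_end.
have /andP[w0 w1] := valP w; rewrite -epoint_in (descendE _ vr pv);
  last by rewrite !ltW.
have [dv _ _ _] := parE vr pv; have := leN v; rewrite dv -natr1 => uN.
set s := if _ then _ else _.
have [s0 s1] : 0 < s /\ s <= 1.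
  by rewrite /s; case: ifP => _; split; rewrite ?subr_gt0// ?gerBl ltW.
rewrite min_r; last by apply: le_trans uN; rewrite lerD2l.
rewrite (geodE _ vr pv) gerDl leNgt s0 /= (addrC _ s) addrK /branch /s.
by case: (src e == u); rewrite ?subKr.
Qed.

Lemma min_lip (h k a b c d : R) : `|a - b| <= d ->
  `|Num.min h (c + a) - Num.min k (c + b)| <= `|h - k| + d.
Proof.
rewrite [in X in _ -> X]ler_norml => ab.
have := ler_norm (a - b); have := ler_norm (b - a).
have := ler_norm (h - k); have := ler_norm (k - h); move: ab.
by rewrite (distrC k) (distrC b) /Num.min; do ?case: ifPn; lra.
Qed.

Lemma descend_lip x : tree x -> exists2 r, 0 < r & forall y (h k : R), tree y ->
  mdist x y < r ->
  mdist (descend x h) (descend y k) <= `|h - k| + mdist x y.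
Proof.
move=> tx; have [r r0 hr] := local_star x.
exists (Num.min r 1) => [|y h k ty]; first by rewrite lt_min r0 ltr01.
rewrite lt_min => /andP[/hr[->|[e [s [t [hs ht xs yt st]]]]] xy1].
  rewrite mdistxx addr0; case: x {tx hr xy1} => [v|[e w]] /=; first exact:
    geod_lip.
  case: (child e) => [[u v]|]; last by rewrite mdistxx.
  apply: le_trans (geod_lip _ _ _) _.
  by rewrite -[leRHS]addr0; apply: min_lip; rewrite subrr normr0.
have [[u [v [vr pv]]]|nte] := EM (tree_edge e).
  rewrite xs yt !(descendE _ vr pv)// -{1}xs -{1}yt.
  apply: le_trans (geod_lip _ _ _) _.
  apply/min_lip/(le_trans _ st); case: ifP => // _.
  by rewrite (_ : 1 - s - (1 - t) = t - s) 1?distrC//; ring.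
(* On an edge outside the tree both points are vertices; being at distance less than 1, they have
   the same parameter. *)
have s01 : s = 0 \/ s = 1.
  by case/unit_itvP: hs => [->|->|hs]; [left|right|move: tx;
    rewrite xs (epointE _ hs)].
have t01 : t = 0 \/ t = 1.
  by case/unit_itvP: ht => [->|->|ht]; [left|right|move: ty;
    rewrite yt (epointE _ ht)].
have st0 : s = t.
  move: (le_lt_trans st xy1).
  by case: s01 => ->; case: t01 => -> //; rewrite ?subr0 ?sub0r ?normrN normr1
    ltxx.
rewrite xs yt st0 mdistxx addr0; case: t01 => ->.
  by rewrite epoint0; exact: geod_lip.
by rewrite epoint1; exact: geod_lip.
Qed.

(** At time [t] every point is lowered along its path to height at most N (1 - t), where [N] is the
    height of the tree. *)
Lemma tree_contractible : contractible tree.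
Proof.
exists (fun z : R * Gam => descend z.2 (N%:R * (1 - z.1))), (vpoint rho); split=>
  //.
- apply/subspace_continuousP => -[t x] /= [ht tx].
  apply/metricType_numDomainType.cvgrPdist_lt => eps eps0.
  have [r r0 hr] := descend_lip tx.
  pose d := Num.min r (eps / 2).
  have d0 : 0 < d by rewrite lt_min r0 divr_gt0.
  (* The height speeds up time by a factor [N]; the successor keeps the denominator positive when
     the tree is a single vertex. *)
  pose k := eps / 2 / N.+1%:R.
  have k0 : 0 < k by rewrite !divr_gt0.
  exists ([set s | `|t - s| < k], [set y | mdist x y < d]) => /=.
    by split; [exists k|apply: (near_mdist d0)].
  move=> [s y] /= [sk xyd] [_ ty]; move: xyd; rewrite lt_min => /andP[xyr xye].
  apply: (le_lt_trans (hr y _ _ ty xyr)); rewrite [ltRHS]splitr; apply: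
    ler_ltD => //.
  rewrite -mulrBr (_ : 1 - t - (1 - s) = s - t); last by ring.
  rewrite normrM distrC ger0_norm//.
  apply: (@le_trans _ _ (N.+1%:R * k)); last by rewrite /k mulrC divfK.
  by apply: ler_pM => //; [rewrite ler_nat|exact: ltW].
- by move=> t x _ _; exact: descend_tree.
- by move=> x tx; rewrite /= subr0 mulr1 descend_top.
- move=> x _; rewrite /= subrr mulr0; case: x => [v|[e w]] /=; first exact: geod0.
  by case: (child e) => [[u v]|//]; apply: geod0; rewrite ge_min lexx.
Qed.

End TreeContraction.

(** * Construction of an integral semibreak divisor *)

Section Existence.
Context {R : realType} {G : graph}.
Local Notation Gam := (mgraph R G).
Implicit Types (e : edge G) (v : vertex G).

(** Sending each vertex other than the root to its parent edge is a bijection onto the tree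
    edges. *)
Lemma card_tree_edges (rho : vertex G) (depth : vertex G -> nat)
    (par : vertex G -> option (vertex G * edge G)) :
  (forall v, v != rho -> exists u e,
    [/\ par v = Some (u, e), depth v = (depth u).+1 &
      (src e = u /\ tgt e = v) \/ (tgt e = u /\ src e = v)]) ->
  #|[set e | `[<tree_edge rho par e>]]%SET| = #|vertex G|.-1.
Proof.
move=> parP; rewrite -(cardsC1 rho).
rewrite -(card_imset _ (@Some_inj _)) -(@card_in_imset _ _ (fun v =>
  omap snd (par v))).
  congr #|mem (_ : {set _})|; apply/setP => o; apply/imsetP/imsetP.
    move=> [e]; rewrite inE => /asboolP[u [v [vr pv]]] ->.
    by exists v; rewrite ?inE// pv.
  move=> [v]; rewrite !inE => vr ->; have [u [e [pv _ _]]] := parP v vr.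
  by exists e; rewrite ?pv// inE; apply/asboolP; exists u, v.
move=> v v'; rewrite !inE => vr vr'.
have [u [e [pv _ _]]] := parP v vr; have [u' [e' [pv' _ _]]] := parP v' vr'.
rewrite pv pv' => -[ee]; rewrite -ee in pv'.
exact: (par_inj parP vr vr' pv pv').
Qed.

(** A spanning tree avoiding [X] leaves out exactly g edges. Their interiors are the segments of a
    break divisor with one chip at [hd e] for each such edge [e]; keeping only the chips of the
    edges in [X] gives the divisor below it. *)
Lemma oriented_semibreak (X : {set edge G}) (hd : edge G -> vertex G) :
  (forall e, hd e = src e \/ hd e = tgt e) -> (forall u v, connect (adj X) u v) ->
  semibreak_divisor (vertex_divisor (fun v =>
    Posz #|[set e in X | hd e == v]%SET|) : divisor R G).
Proof.
move=> hdP connX; have /card_gt0P[rho _] := vertex_gt0 G.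
have [depth [par [depth_rho parX]]] := spanning_tree rho connX.
have parP v : v != rho -> exists u e, [/\ par v = Some (u, e),
  depth v = (depth u).+1 &
      (src e = u /\ tgt e = v) \/ (tgt e = u /\ src e = v)].
  by move=> /parX[u [e [pv _ dv ev]]]; exists u, e.
pose T := [set e | `[<tree_edge rho par e>]]%SET.
have XT : X \subset ~: T.
  apply/fintype.subsetP => e eX; rewrite !inE; apply/asboolPn => -[u [v [vr pv]]].
  by have [u' [e' [pv' e'X _ _]]] := parX v vr; move: e'X; move: pv';
    rewrite pv => -[_ <-]; rewrite eX.
have cardT : genus R G = #|~: T|.
  have := genusE R G; have := cardsC T; rewrite (card_tree_edges parP).
  by have := vertex_gt0 G; lia.
pose ed (i : 'I_(genus R G)) : edge G := enum_val (cast_ord cardT i).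
have sum_ed (F : edge G -> int) : \sum_i F (ed i) = \sum_(e in ~: T) F e.
  rewrite [RHS]big_enum_val [RHS](reindex (cast_ord cardT))//=.
  by exists (cast_ord (esym cardT)) => i _; rewrite ?cast_ordK ?cast_ordKV.
have edT i : ed i \in ~: T by exact: enum_valP.
split=> [x|]; first by rewrite coeff_vertex_divisor; case: x.
exists (\sum_i << (vpoint (hd (ed i)) : Gam) >>); last first.
  move=> x; rewrite coeffB coeff_vertex_divisor coeff_sum_points subr_ge0.
  case: x => [v|z]; last exact: sumr_ge0.
  rewrite (sum_ed (fun e => Posz ((vpoint (hd e) : Gam) == inl v))).
  rewrite -[leLHS]natz -sum1_card natr_sum.
  rewrite (eq_bigl (fun e => (e \in X) && (hd e == v))); last by move=> e;
    rewrite inE.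
  rewrite big_mkcondr/= [leRHS](big_setID X)/= (finset.setIidPr XT).
  rewrite -[leLHS]addr0; apply: lerD; last exact: sumr_ge0.
  apply: ler_sum => e _; case: eqP => // ->; by rewrite eqxx.
exists (fun i => vpoint (hd (ed i))), (fun i => edge_interior (ed i)); split=> //.
- move=> i; split; first exact: edge_interior_segment.
  by apply: closure_edge_interior; case: (hdP (ed i)) => ->; [left|right].
- move=> i j _ _ [x [[u ->] [u' [ee _]]]].
  by have := enum_val_inj ee => /cast_ord_inj.
rewrite (_ : ~` _ = tree rho par); first exact: tree_contractible depth_rho parP.
apply/seteqP; split=> [[v|[e w]] /=|[v|[e w]] /=].
- by [].
- move=> nx; apply: contrapT => nte; apply: nx.
  have eT : e \in ~: T by rewrite !inE; apply/asboolPn.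
  exists (cast_ord (esym cardT) (enum_rank_in eT e)) => //; exists w.
  by rewrite /ed cast_ordKV enum_rankK_in.
- by move=> _ [i _ [u]].
- move=> te [i _ [u [ei _]]]; have := edT i; rewrite -ei !inE => /asboolPn.
  exact.
Qed.

Lemma integral_semibreak_exists D D' : integral_divisor D ->
  deg D <= (genus R G)%:Z ->
  effective D' -> integral_divisor D' -> linear_equiv D D' ->
  exists E : divisor R G, [/\ linear_system D E, semibreak_divisor E &
    integral_divisor E].
Proof.
move=> intD degD effD' intD' DD'.
have [||f E_ge0 balE] := @balanced_divisor R G (fun v => coeff (vpoint v :
  Gam) D').
- by move=> v; exact: effD'.
- by rewrite (equivalent_degree intD intD' DD') -deg_integral.
have [X [hd [EX hdP connX]]] := balanced_orientation E_ge0 balE.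
exists (vertex_divisor (fun v => Posz #|[set e in X | hd e == v]%SET|)).
have [effE sE] := oriented_semibreak hdP connX; split=> //.
(* The sign: the divisor found is D' - lap f, that is, D' + lap (- f). *)
- split=> //; apply: (linear_equiv_fire (f := fun v => - f v) DD') => x.
  rewrite coeffB coeff_vertex_divisor; case: x => [v|z].
    by rewrite -EX lapN; ring.
  rewrite sub0r; apply/eqP; rewrite oppr_eq0; apply: contraT => /intD'[v]; by [].
- by move=> x; rewrite coeff_vertex_divisor; case: x => [v _|z];
  [exists v|rewrite eqxx].
Qed.

End Existence.

Theorem theoremC (R : realType) (G : graph)
    (not_point : ~ is_point (mgraph R G))
    (not_circle : ~ is_circle (mgraph R G))
    (d : nat) (d_le_g : (d <= genus R G)%N)
    (D : divisor R G) (D_integral : integral_divisor D) (D_deg : deg D = d%:Z)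
    (D_effective : exists D' : divisor R G,
       [/\ effective D', integral_divisor D' & linear_equiv D D']) :
  (exists E : divisor R G,
     [/\ linear_system D E, semibreak_divisor E & integral_divisor E]) /\
  (forall E : divisor R G,
     linear_system D E -> semibreak_divisor E -> integral_divisor E).
Proof.
split=> [|E [_ ED]]; last exact: semibreak_integral D_integral ED.
have [D' [effD' intD' DD']] := D_effective.
by apply: (integral_semibreak_exists D_integral _ effD' intD' DD'); rewrite D_deg lez_nat.
Qed.
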